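(* For every integer $n>12$, $$\delta(A_n)\geq\min\{\delta(A_{n-1})+2,\ \delta(A_{n-2})+4,\ \delta(A_{n-5})+10,\ \delta(A_{n-6})+12\}.$$
   Context: Polygons are treated combinatorially: a convex polygon is a finite set of at least $3$ vertices with a clockwise cyclic order. An edge is a $2$-element set of vertices; two edges cross if they are disjoint and their vertices alternate in the cyclic order. Boundary edges are pairs of cyclically consecutive vertices. A triangulation is an inclusion-maximal set of pairwise non-crossing edges. For an interior edge $\varepsilon$ of a triangulation $T$, $\varepsilon$ is a diagonal of a unique quadrilateral whose four sides lie in $T$; replacing $\varepsilon$ with the other diagonal is a flip. For a pair $P=\{U,V\}$ of triangulations of the same polygon, $\delta(P)$ is the minimum number of flips transforming $U$ into $V$ (flip distance). Deletion: if $a$ is a vertex of a polygon $\pi$ with at least $4$ vertices and $b$ its clockwise successor, $\pi\ominus a$ is the polygon with vertex $a$ removed, and for a triangulation $T$ of $\pi$, $T\ominus a=\{\varepsilon \text{ with } a \text{ replaced by } b : \varepsilon\in T\setminus\{\{a,b\}\}\}$, a triangulation of $\pi\ominus a$. Zigzag: for $N\geq 4$, on the polygon with vertices $0,\dots,N-1$ labeled clockwise (labels modulo $N$), $Z_N$ is the triangulation whose interior edges are $\varepsilon_1,\dots,\varepsilon_{N-3}$ with $\varepsilon_{2k+1}=\{2-k,4+k\}$ and $\varepsilon_{2k+2}=\{1-k,4+k\}$ for $k\geq 0$. In a polygon with $N$ vertices, $\bar{k}$ denotes vertex $k+\lfloor N/2\rfloor$. Pair $A_n$ ($n\geq 3$):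 $A_n^-$ is obtained from $Z_{n+4}$ by deleting successively $0$, $1$, $\bar 0$, $\bar 1$ (with $\bar k=k+\lfloor (n+4)/2\rfloor$, labels of $Z_{n+4}$), then relabeling the remaining $n$ vertices clockwise $0,\dots,n-1$ so that vertex $2$ keeps label $2$. $A_n^+$ is obtained from $Z_{n+4}$ by deleting successively $4$, $5$, $\bar 4$, $\bar 5$, then relabeling clockwise $0,\dots,n-1$ so that the former vertex $2$ gets label $1$. Both are triangulations of the polygon with vertices $0,\dots,n-1$ in clockwise order; $A_n=\{A_n^-,A_n^+\}$. *)

(* Defs.v *)
From mathcomp Require Import all_boot all_order all_algebra.

Set Implicit Arguments.
Unset Strict Implicit.
Unset Printing Implicit Defensive.

(* A polygon is given by the list p of its vertices in clockwise order; all
   notions below depend on a duplicate-free p only up to rotation. *)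
Section Polygon.

Variable T : finType.
Implicit Types (p : seq T) (a b c d v : T) (e f : {set T}) (U V : {set {set T}}).

Definition polygon p : bool := uniq p && (2 < size p).

(* a, b, c are distinct and met in this order when going clockwise. *)
Definition clockwise p a b c : bool :=
  let i := index a p in let j := index b p in let k := index c p in
  [|| i < j < k, j < k < i | k < i < j].

Definition edges p : {set {set T}} := [set e : {set T} | (e \subset p) && (#|e| == 2)].

Definition boundary p : {set {set T}} := [set [set v; next p v] | v in p].

Definition crossing p e f : bool :=
  [disjoint e & f] &&
  [exists a, exists b, exists c, exists d,
    [&& e == [set a; c], f == [set b; d], clockwise p a b c & clockwise p c d a]].

Definition noncrossing p U : bool :=
  [forall e in U, forall f in U, ~~ crossing p e f].

Definition triangulation p U : bool :=
  polygon p && maxset (fun S => (S \subset edges p) && noncrossing p S) U.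

(* a, b, c, d are the clockwise vertices of the quadrilateral; its diagonal
   {a, c} is replaced by {b, d}. *)
Definition flip p : rel {set {set T}} := fun U V =>
  triangulation p U &&
  [exists a, exists b, exists c, exists d,
    [&& clockwise p a b c, clockwise p c d a, [set a; c] \in U,
        [&& [set a; b] \in U, [set b; c] \in U, [set c; d] \in U
          & [set d; a] \in U]
      & V == [set b; d] |: (U :\ [set a; c])]].

Definition flip_reach p U V (k : nat) : bool :=
  [exists s : k.-tuple {set {set T}}, path (flip p) U s && (last U s == V)].

(* A shortest flip path does not repeat a vertex of the flip graph, so its
   length is in the range of iota; see flip_distP. *)
Definition flip_dist p U V : nat :=
  find (flip_reach p U V) (iota 0 #|{set {set T}}|).

Lemma flip_reachP p U V k :
  reflect (exists s, [/\ path (flip p) U s, last U s = V & size s = k])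
          (flip_reach p U V k).
Proof.
apply: (iffP existsP) => [[s /andP[ps /eqP ls]]|[s [ps ls /eqP sk]]].
  by exists s; rewrite size_tuple.
by exists (Tuple sk); rewrite ps ls eqxx.
Qed.

Lemma flip_distP p U V s : path (flip p) U s -> last U s = V ->
  flip_reach p U V (flip_dist p U V) /\ flip_dist p U V <= size s.
Proof.
move=> ps; case: (shortenP ps) => s' ps' us' sub ls'.
have ss' : size s' < #|{set {set T}}|.
  by have := max_card [in U :: s']; rewrite (card_uniqP us').
have le_s : size s' <= size s.
  by apply: uniq_leq_size => //; case/andP: us'.
have r' : flip_reach p U V (size s').
  by apply/flip_reachP; exists s'.
have hs : has (flip_reach p U V) (iota 0 #|{set {set T}}|).
  by apply/hasP; exists (size s'); rewrite // mem_iota.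
split.
  have := nth_find 0 hs; rewrite nth_iota //.
  by rewrite has_find size_iota in hs.
apply: leq_trans le_s; rewrite leqNgt; apply/negP => lt.
have := before_find 0 lt; rewrite nth_iota ?add0n ?r' //.
Qed.

(* Deletion of the vertex a; U is meant to be a triangulation of p. *)
Definition deletion p U a : {set {set T}} :=
  [set [set (if v == a then next p a else v) | v in e]
      | e : {set T} in U :\ [set a; next p a]].

Definition delete_step (pU : seq T * {set {set T}}) a :=
  (rem a pU.1, deletion pU.1 pU.2 a).

Definition delete_seq p U (s : seq T) : seq T * {set {set T}} :=
  foldl delete_step (p, U) s.

(* Relabelling of a polygon p with n vertices, clockwise by 0, ..., n - 1, so
   that v gets the label l <= n: the label i goes to the vertex reached from v
   in i - l (mod n) clockwise steps. *)
Definition labelled p v (l n : nat) (i : 'I_n) : T :=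
  iter (i + (n - l)) (next p) v.

Definition relabel (pU : seq T * {set {set T}}) v (l n : nat) :
    {set {set 'I_n}} :=
  [set e : {set 'I_n} | [set labelled pU.1 v l i | i in e] \in pU.2].

End Polygon.

Section Zigzag.
Import GRing.Theory.
Local Open Scope ring_scope.

Definition std_polygon (n : nat) : seq 'I_n := enum 'I_n.

(* N = m + 4; arithmetic in the ring 'I_N is arithmetic of labels modulo N. *)
Definition zigzag_edge (m j : nat) : {set 'I_m.+4} :=
  let k := (j.-1)./2 in
  if odd j then [set 2%:R - k%:R; 4%:R + k%:R]
  else [set 1%:R - k%:R; 4%:R + k%:R].

(* The zigzag Z_(m + 4), with interior edges indexed by j = 1, ..., m + 1. *)
Definition zigzag (m : nat) : {set {set 'I_m.+4}} :=
  boundary (std_polygon m.+4)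
    :|: [set zigzag_edge m (j : 'I_m.+1).+1 | j in 'I_m.+1].

Definition opp_vertex (m k : nat) : 'I_m.+4 := k%:R + ((m.+4)./2)%:R.

Definition A_minus (n : nat) : {set {set 'I_n}} :=
  relabel (delete_seq (std_polygon n.+4) (zigzag n)
             [:: 0%:R; 1%:R; opp_vertex n 0; opp_vertex n 1]) 2%:R 2 n.

Definition A_plus (n : nat) : {set {set 'I_n}} :=
  relabel (delete_seq (std_polygon n.+4) (zigzag n)
             [:: 4%:R; 5%:R; opp_vertex n 4; opp_vertex n 5]) 2%:R 1 n.

End Zigzag.

Definition delta_A (n : nat) : nat :=
  flip_dist (std_polygon n) (A_minus n) (A_plus n).

(* Main.v *)
(* Let a flip path lead from A_n^- to A_n^+.  Contracting the polygon onto a smaller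
   one turns every flip into a flip or into the identity, so if k flips are undone by
   a contraction then the contracted triangulations are at distance at most the
   length of the path minus k.  Write the vertices modulo n, and contract the vertices
   of one of S1 = {1}, S2 = {1, 3}, S5 = {-1, 0, 1, 2, 4}, S6 = {-1, 0, 1, 2, 4, 5} onto
   their clockwise successors: up to a rotation or a reflection, the contracted pair is
   A_{n-1}, A_{n-2}, A_{n-5}, A_{n-6} respectively.  Hence it suffices that one of these
   contractions undoes at least 2, 4, 10, 12 flips respectively.

   This is a finite statement.  Contract the polygon onto the 12 vertices -4, ..., 7:
   for n > 12 the images of A_n^- and A_n^+ do not depend on n, and a flip of the
   12-gon that is undone by the contraction of S1, S2, S5 or S6 comes from a flip of
   the n-gon that is undone by the same contraction.  A computation then shows that
   every flip path between the two triangulations of the 12-gon has enough such flips. *)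

(* That A_n^- and A_n^+ are triangulations is never derived from their construction. A flip path
   joining them is nonempty, since they differ, and [flip] requires a triangulation at its source;
   without any path, [flip_dist] takes its default value [#|{set {set 'I_n}}|], which grows fast
   enough with n for the bound to hold. Likewise, the contraction of a triangulation is again a
   triangulation, hence equal to any non-crossing set of edges that contains it: identifying it with
   A_m takes one inclusion and no maximality of A_m. Rotations and reflections are built into the
   contracting maps, so the only symmetry of flip graphs that matters is the reversibility of flips;
   it serves S1 and S5, whose maps are reflections exchanging the two ends of the pair. The
   computation works on states, a triangulation of the 12-gon with four counters of undone flips, up
   to domination: the same triangulation with no larger counters is at least as good. The condition
   n > 12 gives n - 6 > 6, the range in which the edges of A_m are given by explicit formulas. *)
Require Import Defs.
From mathcomp Require Import all_boot all_order all_algebra.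
From mathcomp Require Import zify.

Set Implicit Arguments.
Unset Strict Implicit.
Unset Printing Implicit Defensive.

(** * Crossing chords *)

(* The chords {a, c} and {b, d} of a polygon labelled in cyclic order cross. *)
Definition separates (a c b d : nat) : bool :=
  [&& a != b, a != d, c != b, c != d
    & ((a < b) (+) (c < b)) (+) ((a < d) (+) (c < d))].

Definition rank (s : seq nat) (x : nat) : nat := count (fun y => y < x) s.

Lemma ltn_rank s x y : x \in s -> (rank s x < rank s y) = (x < y).
Proof.
move=> xs; apply/idP/idP => [|xy]; last first.
  have /eq_count e : (fun z => z < y) =1 [predU (fun z => z < x) & (fun z => x <= z < y)].
    by move=> z /=; lia.
  have e0 : count [predI (fun z => z < x) & (fun z => x <= z < y)] s = 0.
    by rewrite -(count_pred0 s); apply: eq_count => z /=; lia.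
  have h : 0 < count (fun z => x <= z < y) s.
    by rewrite -has_count; apply/hasP; exists x => //; rewrite leqnn.
  by rewrite /rank e -[ltnRHS]addn0 -e0 count_predUI -[ltnLHS]addn0 ltn_add2l.
apply: contraTT; rewrite -!leqNgt => yx; apply: sub_count => z /= zy; lia.
Qed.

Lemma eq_rank s x y : x \in s -> y \in s -> (rank s x == rank s y) = (x == y).
Proof. by move=> xs ys; rewrite !eqn_leq; congr andb; rewrite leqNgt ltn_rank // -leqNgt. Qed.

Lemma rank_iota s x : x \in s -> rank s x \in iota 0 (size s).
Proof.
move=> xs; rewrite mem_iota /= add0n.
by rewrite ltn_neqAle count_size andbT -all_count; apply/negP => /allP/(_ x xs); rewrite ltnn.
Qed.

Lemma separates_rank s a c b d : a \in s -> c \in s -> b \in s -> d \in s ->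
  separates (rank s a) (rank s c) (rank s b) (rank s d) = separates a c b d.
Proof. by move=> ha hc hb hd; rewrite /separates !eq_rank // !ltn_rank. Qed.

Definition all4 n (P : nat -> nat -> nat -> nat -> bool) : bool :=
  let r := iota 0 n in
  all (fun a => all (fun b => all (fun c => all (P a b c) r) r) r) r.

Lemma all4_rank s P a b c d : all4 (size s) P ->
  a \in s -> b \in s -> c \in s -> d \in s ->
  P (rank s a) (rank s b) (rank s c) (rank s d).
Proof.
move=> h /rank_iota ha /rank_iota hb /rank_iota hc /rank_iota hd.
by move: h => /allP/(_ _ ha)/allP/(_ _ hb)/allP/(_ _ hc)/allP/(_ _ hd).
Qed.

Definition all6 n (P : nat -> nat -> nat -> nat -> nat -> nat -> bool) : bool :=
  all (fun a => all (fun b => all4 n (P a b)) (iota 0 n)) (iota 0 n).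

Lemma all6_rank s P a b c d e f : all6 (size s) P ->
  a \in s -> b \in s -> c \in s -> d \in s -> e \in s -> f \in s ->
  P (rank s a) (rank s b) (rank s c) (rank s d) (rank s e) (rank s f).
Proof.
move=> h /rank_iota ha /rank_iota hb.
by move: h => /allP/(_ _ ha)/allP/(_ _ hb); apply: all4_rank.
Qed.

(* A statement about the relative order of a few numbers is checked on their ranks. *)
Ltac by_rank4 P a b c d :=
  have := @all4_rank [:: a; b; c; d] P a b c d (ltac:(by vm_compute));
  rewrite !separates_rank ?eq_rank ?inE ?eqxx ?orbT //; move=> /(_ isT isT isT isT).

Ltac by_rank6 P a b c d x y :=
  have := @all6_rank [:: a; b; c; d; x; y] P a b c d x y (ltac:(by vm_compute));
  rewrite !separates_rank ?eq_rank ?inE ?eqxx ?orbT //; move=> /(_ isT isT isT isT isT isT).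

Lemma separatesC a c b d : separates a c b d = separates b d a c.
Proof.
by apply/eqP; by_rank4 (fun a b c d => separates a c b d == separates b d a c) a b c d.
Qed.

Lemma separates_swapl a c b d : separates a c b d = separates c a b d.
Proof.
by apply/eqP; by_rank4 (fun a b c d => separates a c b d == separates c a b d) a b c d.
Qed.

Lemma separates_swapr a c b d : separates a c b d = separates a c d b.
Proof. by rewrite separatesC separates_swapl separatesC. Qed.

Lemma separates_neq a c b d : separates a c b d ->
  [/\ a != b, b != c, c != d, d != a & (a != c) && (b != d)].
Proof.
case/and5P => ab ad cb cd h; split; rewrite // 1?eq_sym //.
by apply/andP; split; apply: contraTneq h => ->; rewrite ?addbb.
Qed.

Lemma separates_total a b c d :
  a != b -> b != c -> c != d -> d != a -> a != c -> b != d ->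
  [|| separates a c b d, separates a b c d | separates a d b c].
Proof.
move=> ab bc cd da ac bd.
by_rank4 (fun a b c d => (a == b) || (b == c) || (c == d) || (d == a) || (a == c) || (b == d)
  || [|| separates a c b d, separates a b c d | separates a d b c]) a b c d.
by rewrite (negPf ab) (negPf bc) (negPf cd) (negPf da) (negPf ac) (negPf bd).
Qed.

Lemma separates_excl a b c d : separates a c b d ->
  ~~ separates a b c d && ~~ separates a d b c.
Proof.
move=> h; by_rank4 (fun a b c d => separates a c b d ==>
  ~~ separates a b c d && ~~ separates a d b c) a b c d.
by rewrite h.
Qed.

(** A chord crossing the diagonal {a, c} leaves the quadrilateral on both sides of it, either
    through a side or at a corner. This is why the other diagonal is the only possible replacement
    in a flip. *)
Lemma separates_quad a b c d x y : separates a c b d -> separates x y a c ->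
  ~~ separates x y a b -> ~~ separates x y b c -> ~~ separates x y c d ->
  ~~ separates x y d a -> ((x == b) && (y == d)) || ((x == d) && (y == b)).
Proof.
move=> h1 h2 h3 h4 h5 h6.
by_rank6 (fun a b c d x y => separates a c b d ==> separates x y a c ==>
  ~~ separates x y a b ==> ~~ separates x y b c ==> ~~ separates x y c d ==>
  ~~ separates x y d a ==> ((x == b) && (y == d)) || ((x == d) && (y == b))) a b c d x y.
by rewrite h1 h2 h3 h4 h5 h6.
Qed.

(** The chord {u, v} has x and y on different sides. As {p, q} stays on one side of {u, v} and meets
    {u, y}, it lies on the side of y and cuts y off from everything beyond {u, v}, in particular
    from x. *)
Lemma separates_shift x y u v p q : separates x y u v ->
  ~~ separates p q u v -> separates p q u y -> separates p q x y.
Proof.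
move=> h1 h2 h3.
by_rank6 (fun x y u v p q => separates x y u v ==> ~~ separates p q u v ==>
  separates p q u y ==> separates p q x y) x y u v p q.
by rewrite h1 h2 h3.
Qed.

(** A chord crossing no side of the quadrilateral is a diagonal or lives over a single side, and
    then one of its ends lies strictly behind that side. It is applied with a', c' having the same
    images as a, c under a contraction: each alternative of the conclusion is then a crossing of a
    contracted chord with one whose ends are mapped elsewhere, which is absurd. *)
Lemma separates_lift a b c d a' c' : separates a c b d ->
  ~~ separates a' c' a b -> ~~ separates a' c' b c -> ~~ separates a' c' c d ->
  ~~ separates a' c' d a ->
  [|| a' == b, a' == c, a' == d, c' == a, c' == b | c' == d] = false ->
  (a' == a) && (c' == c) = false ->
  [|| separates c c' a b, separates c c' d a, separates a a' b c
    | separates a a' c d].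
Proof.
move=> h1 h2 h3 h4 h5 h6 h7.
by_rank6 (fun a b c d a' c' => separates a c b d ==>
  ~~ separates a' c' a b ==> ~~ separates a' c' b c ==> ~~ separates a' c' c d ==>
  ~~ separates a' c' d a ==> [|| a' == b, a' == c, a' == d, c' == a, c' == b | c' == d]
  || ((a' == a) && (c' == c)) || [|| separates c c' a b, separates c c' d a, separates a a' b c
    | separates a a' c d]) a b c d a' c'.
by rewrite h1 h2 h3 h4 h5 h6 h7.
Qed.

(** * Triangulations and flips of the standard polygon *)

Lemma set2_eqP (T : finType) (a b c d : T) :
  reflect ((a = c /\ b = d) \/ (a = d /\ b = c)) ([set a; b] == [set c; d]).
Proof.
apply: (iffP eqP) => [e|[[-> ->]|[-> ->]]]; rewrite // 1?setUC //.
have ha : a \in [set c; d] by rewrite -e set21.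
have hb : b \in [set c; d] by rewrite -e set22.
have hc : c \in [set a; b] by rewrite e set21.
have hd : d \in [set a; b] by rewrite e set22.
case/set2P: ha => ea; case/set2P: hb => eb; case/set2P: hc => ec; case/set2P: hd => ed;
  by subst; auto.
Qed.

Section Triangulations.

Variable n : nat.
Implicit Types (U V W : {set {set 'I_n}}) (a b c d x y u v : 'I_n).

Record is_triangulation U : Prop := IsTriangulation {
  tri_card : forall e, e \in U -> #|e| = 2;
  tri_nc : forall a c b d, [set a; c] \in U -> [set b; d] \in U ->
    ~~ separates a c b d;
  tri_max : forall x y, x != y ->
    (forall u v, [set u; v] \in U -> ~~ separates x y u v) -> [set x; y] \in U }.

Lemma clockwise_std a b c : clockwise (std_polygon n) a b c =
  [|| a < b < c, b < c < a | c < a < b].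
Proof. by rewrite /clockwise /std_polygon !index_enum_ord. Qed.

Lemma separates_clockwise a b c d : separates a c b d =
  (clockwise (std_polygon n) a b c && clockwise (std_polygon n) c d a)
  || (clockwise (std_polygon n) a d c && clockwise (std_polygon n) c b a).
Proof.
rewrite !clockwise_std /separates.
case: (ltngtP a b) => ab; case: (ltngtP b c) => bc; case: (ltngtP c d) => cd;
  case: (ltngtP a d) => ad; case: (ltngtP a c) => ac //=; lia.
Qed.

Lemma crossing_std a c b d :
  crossing (std_polygon n) [set a; c] [set b; d] = separates a c b d.
Proof.
apply/andP/idP => [[dis /existsP[a' /existsP[b' /existsP[c' /existsP[d']]]]]|h].
  case/and4P => /set2_eqP e1 /set2_eqP e2 h1 h2.
  have : separates a' c' b' d' by rewrite separates_clockwise h1 h2.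
  case: e1 e2 => [[-> ->]|[-> ->]] [[-> ->]|[-> ->]] //.
  - by rewrite separates_swapr.
  - by rewrite separates_swapl.
  by rewrite separates_swapl separates_swapr.
split.
  have [ab bc cd da _] := separates_neq h.
  rewrite !(inj_eq (@ord_inj n)) in ab bc cd da.
  rewrite disjoints_subset subUset !sub1set !inE !negb_or.
  by rewrite ab cd (eq_sym c b) bc (eq_sym a d) da.
move: h; rewrite separates_clockwise => /orP[/andP[h1 h2]|/andP[h1 h2]].
  apply/existsP; exists a; apply/existsP; exists b; apply/existsP; exists c.
  by apply/existsP; exists d; rewrite !eqxx h1 h2.
apply/existsP; exists a; apply/existsP; exists d; apply/existsP; exists c.
by apply/existsP; exists b; rewrite setUC eqxx h1 h2 setUC eqxx.
Qed.

Lemma noncrossing_std U : (forall e, e \in U -> #|e| = 2) ->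
  reflect (forall a c b d, [set a; c] \in U -> [set b; d] \in U -> ~~ separates a c b d)
    (noncrossing (std_polygon n) U).
Proof.
move=> U2; apply: (iffP forall_inP) => [h a c b d h1 h2|h e he].
  by rewrite -crossing_std; apply: (forall_inP (h _ h1)).
apply/forall_inP => f hf.
have /eqP/cards2P[a [c [_ e1]]] := U2 _ he; have /eqP/cards2P[b [d [_ e2]]] := U2 _ hf.
by move: he hf; rewrite e1 e2 crossing_std; apply: h.
Qed.

Lemma edges_std U :
  reflect (forall e, e \in U -> #|e| = 2) (U \subset edges (std_polygon n)).
Proof.
apply: (iffP subsetP) => h e /h; first by rewrite inE => /andP[_ /eqP].
by rewrite inE => ->; rewrite eqxx andbT; apply/subsetP => x _; rewrite mem_enum.
Qed.

(** Non-crossing is a condition on pairs of edges, so maximality among sets amounts to maximality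
    against adding a single chord. *)
Lemma triangulation_std U :
  triangulation (std_polygon n) U <-> 2 < n /\ is_triangulation U.
Proof.
rewrite /triangulation /polygon enum_uniq size_enum_ord /=; split.
  case/andP => n2 /maxsetP[/andP[/edges_std U2 nc] mx]; split => //.
  split => // [|x y xy h]; first by apply/noncrossing_std.
  rewrite -(mx ([set x; y] |: U)) ?subsetUr ?setU11 //.
  have E : forall e, e \in [set x; y] |: U -> #|e| = 2.
    by move=> e /setU1P[->|/U2//]; rewrite cards2 xy.
  apply/andP; split; first exact/edges_std.
  apply/(noncrossing_std E) => a c b d /setU1P[/eqP/set2_eqP e1|h1] /setU1P[/eqP/set2_eqP e2|h2].
  - apply/negP => /separates_neq[ab bc cd da _].
    by case: e1 e2 => [[e1 e2]|[e1 e2]] [[e3 e4]|[e3 e4]]; subst; rewrite eqxx in ab bc cd da *.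
  - by case: e1 => [[-> ->]|[-> ->]]; rewrite 1?[separates y x _ _]separates_swapl; apply: h.
  - by case: e2 => [[-> ->]|[-> ->]]; rewrite separatesC 1?[separates y x _ _]separates_swapl;
      apply: h.
  by move/(noncrossing_std U2): nc; apply.
case=> -> [U2 nc mx]; apply/maxsetP; split.
  by apply/andP; split; [apply/edges_std|apply/noncrossing_std].
move=> W /andP[/edges_std W2 /(noncrossing_std W2) Wnc] UW; apply/eqP.
rewrite eqEsubset UW andbT; apply/subsetP => e eW.
have /eqP/cards2P[x [y [xy e_xy]]] := W2 _ eW; rewrite e_xy in eW *.
by apply: mx => // u v /(subsetP UW); apply: Wnc.
Qed.

(** This turns an inclusion into an equality, with nothing but the absence of crossings asked from
    the larger set. *)
Lemma triangulation_maximal U W : is_triangulation U ->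
  (forall e, e \in W -> #|e| = 2) ->
  (forall a c b d, [set a; c] \in W -> [set b; d] \in W -> ~~ separates a c b d) ->
  U \subset W -> U = W.
Proof.
case=> U2 nc mx W2 Wnc UW; apply/eqP; rewrite eqEsubset UW.
apply/subsetP => e eW.
have /eqP/cards2P[x [y [xy e_xy]]] := W2 _ eW; rewrite e_xy in eW *.
by apply: mx => // u v /(subsetP UW); apply: Wnc.
Qed.

Definition quad_flip U V a b c d : Prop :=
  [/\ separates a c b d, [set a; c] \in U,
      [/\ [set a; b] \in U, [set b; c] \in U, [set c; d] \in U & [set d; a] \in U]
    & V = [set b; d] |: (U :\ [set a; c])].

Lemma flip_stdP U V : flip (std_polygon n) U V <->
  triangulation (std_polygon n) U /\ exists a b c d, quad_flip U V a b c d.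
Proof.
rewrite /flip; split=> [/andP[-> /existsP[a /existsP[b /existsP[c /existsP[d]]]]]|].
  case/and5P => h1 h2 h3 /and4P[h4 h5 h6 h7] /eqP h8.
  by split=> //; exists a, b, c, d; split; rewrite // separates_clockwise h1 h2.
case=> -> [a [b [c [d]]]] [] ; rewrite separates_clockwise.
case/orP=> /andP[h1 h2] h3 [h4 h5 h6 h7] h8; apply/existsP; exists a; apply/existsP.
  exists b; apply/existsP; exists c; apply/existsP; exists d.
  by rewrite h1 h2 h3 h4 h5 h6 h7 h8 /=.
exists d; apply/existsP; exists c; apply/existsP; exists b; rewrite h1 h2 h3 h8 /=.
rewrite [ [set d; c] ]setUC [ [set c; b] ]setUC [ [set a; d] ]setUC [ [set b; a] ]setUC.
by rewrite h4 h5 h6 h7 [ [set b; d] ]setUC eqxx.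
Qed.

Lemma quad_sides_neq a b c d : separates a c b d ->
  [/\ [set a; b] != [set a; c], [set b; c] != [set a; c],
      [set c; d] != [set a; c] & [set d; a] != [set a; c]].
Proof.
move=> /separates_neq[k1 k2 k3 k4 /andP[k5 _]].
rewrite !(inj_eq (@ord_inj n)) in k1 k2 k3 k4 k5.
by split; apply/set2_eqP => -[[e1 e2]|[e1 e2]]; subst; rewrite eqxx in k1 k2 k3 k4 k5.
Qed.

(** Both halves rest on [separates_quad]. An old edge crossing {b, d} crosses no side, so it is {a,
    c}. Conversely, a chord compatible with V either crosses {a, c}, and is then {b, d}, or is
    compatible with U, and is not {a, c}, which crosses {b, d}. *)
Lemma quad_flip_triangulation U V a b c d : is_triangulation U ->
  quad_flip U V a b c d -> is_triangulation V.
Proof.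
move=> triU [sep ac [ab bc cd da] ->]; have [U2 nc mx] := triU.
have [_ _ _ _ /andP[_ bd]] := separates_neq sep.
have bd_nc u v : [set u; v] \in U -> [set u; v] != [set a; c] -> ~~ separates b d u v.
  move=> uv; apply: contra; rewrite separatesC => h.
  have sep' : separates b d c a by rewrite separatesC separates_swapl.
  have /orP[] := separates_quad sep' h (nc _ _ _ _ uv bc) (nc _ _ _ _ uv cd)
    (nc _ _ _ _ uv da) (nc _ _ _ _ uv ab).
    by case/andP=> /eqP/val_inj -> /eqP/val_inj ->; rewrite setUC.
  by case/andP=> /eqP/val_inj -> /eqP/val_inj ->.
split.
- by move=> e /setU1P[->|/setD1P[_ /U2//]]; rewrite cards2 bd.
- move=> x x' y y' /setU1P[/eqP/set2_eqP e1|/setD1P[n1 h1]]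
    /setU1P[/eqP/set2_eqP e2|/setD1P[n2 h2]].
  + apply/negP => /separates_neq[k1 k2 k3 k4 _].
    by case: e1 e2 => [[e1 e2]|[e1 e2]] [[e3 e4]|[e3 e4]]; subst; rewrite eqxx in k1 k2 k3 k4 *.
  + by case: e1 => [[-> ->]|[-> ->]]; rewrite 1?[separates d b _ _]separates_swapl; apply: bd_nc.
  + by case: e2 => [[-> ->]|[-> ->]]; rewrite separatesC 1?[separates d b _ _]separates_swapl;
      apply: bd_nc.
  exact: nc.
move=> x y xy h.
have side u v : [set u; v] \in U -> [set u; v] != [set a; c] -> ~~ separates x y u v.
  by move=> uv ne; apply: h; rewrite !inE uv ne orbT.
have [nab nbc ncd nda] := quad_sides_neq sep.
have [xyac|nxyac] := boolP (separates x y a c).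
  have /orP[] := separates_quad sep xyac (side _ _ ab nab) (side _ _ bc nbc)
    (side _ _ cd ncd) (side _ _ da nda).
    by case/andP=> /eqP/val_inj -> /eqP/val_inj ->; rewrite setU11.
  by case/andP=> /eqP/val_inj -> /eqP/val_inj ->; rewrite [ [set d; b] ]setUC setU11.
rewrite !inE; have [e|ne] := eqVneq [set x; y] [set a; c].
  have := h b d (setU11 _ _); move/eqP/set2_eqP: e => [[-> ->]|[-> ->]]; first by rewrite sep.
  by rewrite separates_swapl sep.
rewrite mx ?orbT // => u v uv; have [e|ne'] := eqVneq [set u; v] [set a; c]; last exact: side.
move/eqP/set2_eqP: e => [[-> ->]|[-> ->]] //.
by rewrite separates_swapr.
Qed.

Lemma flip_triangulation U V : flip (std_polygon n) U V ->
  triangulation (std_polygon n) V.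
Proof.
case/flip_stdP => /triangulation_std[n2 triU] [a [b [c [d q]]]].
by apply/triangulation_std; split=> //; apply: quad_flip_triangulation q.
Qed.

Lemma quad_flip_sym U V a b c d : is_triangulation U ->
  quad_flip U V a b c d -> quad_flip V U b c d a.
Proof.
move=> [_ nc _] [sep ac [ab bc cd da] ->].
have nbd : [set b; d] \notin U by apply: contraL sep; apply: nc.
have [nab nbc ncd nda] := quad_sides_neq sep.
split.
- by rewrite separatesC separates_swapl.
- exact: setU11.
- by split; apply/setU1P; right; apply/setD1P.
rewrite setU1K ?inE ?negb_and ?nbd ?orbT // [ [set c; a] ]setUC.
by rewrite setD1K.
Qed.

Lemma flip_sym U V : flip (std_polygon n) U V -> flip (std_polygon n) V U.
Proof.
move=> f; have triV := flip_triangulation f.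
case/flip_stdP: f => /triangulation_std[_ triU] [a [b [c [d q]]]].
by apply/flip_stdP; split=> //; exists b, c, d, a; apply: quad_flip_sym.
Qed.

End Triangulations.

(** * Contractions *)

Section Contraction.

Variables (n m : nat) (f : 'I_n -> 'I_m).
Implicit Types (U V W : {set {set 'I_n}}) (a b c d x y u v : 'I_n).

Definition collapsed a b c d : bool :=
  [|| f a == f b, f b == f c, f c == f d | f d == f a].

(* A quadrilateral is mapped to a quadrilateral, or to a degenerate one having a
   side contracted to a point. *)
Definition cyclic_map : Prop := forall a b c d, separates a c b d ->
  separates (f a) (f c) (f b) (f d) || collapsed a b c d.

Definition contraction U : {set {set 'I_m}} :=
  [set [set f p.1; f p.2] |
     p in [set p : 'I_n * 'I_n | ([set p.1; p.2] \in U) && (f p.1 != f p.2)]].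

Lemma contractionP U (e : {set 'I_m}) :
  reflect (exists x y, [/\ [set x; y] \in U, f x != f y & e = [set f x; f y]])
    (e \in contraction U).
Proof.
apply: (iffP imsetP) => [[[x y]]|[x [y [xy ne ->]]]].
  by rewrite inE => /andP[xy ne] ->; exists x, y.
by exists (x, y); rewrite // inE xy.
Qed.

Lemma mem_contraction U x y : [set x; y] \in U -> f x != f y ->
  [set f x; f y] \in contraction U.
Proof. by move=> xy ne; apply/contractionP; exists x, y. Qed.

Lemma contraction2P U (i j : 'I_m) : [set i; j] \in contraction U ->
  exists x y, [/\ [set x; y] \in U, f x != f y, f x = i & f y = j].
Proof.
case/contractionP => x [y [xy ne /eqP/set2_eqP[[-> ->]|[-> ->]]]]; first by exists x, y.
by exists y, x; split; rewrite // 1?eq_sym // setUC.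
Qed.

Lemma contraction_card U (e : {set 'I_m}) : e \in contraction U -> #|e| = 2.
Proof. by case/contractionP => x [y [_ ne ->]]; rewrite cards2 ne. Qed.

Fixpoint collapses U (s : seq {set {set 'I_n}}) : nat :=
  if s is V :: s' then (contraction U == contraction V) + collapses V s' else 0.

Hypothesis f_cyclic : cyclic_map.

(** Four distinct points have exactly one crossing pairing. If upstairs it were another one, its
    image would also cross, no side being collapsed, and the images would have two crossing
    pairings. *)
Lemma separates_contraction a b c d :
  separates (f a) (f c) (f b) (f d) -> separates a c b d.
Proof.
move=> h; have [k1 k2 k3 k4 /andP[k5 k6]] := separates_neq h.
have ne x y : nat_of_ord (f x) != f y -> nat_of_ord x != y.
  by apply: contraNneq => /val_inj ->.
have /andP[h1 h2] := separates_excl h.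
have /or3P[//|s|s] := separates_total (ne _ _ k1) (ne _ _ k2) (ne _ _ k3) (ne _ _ k4)
  (ne _ _ k5) (ne _ _ k6); have := f_cyclic s; rewrite ?(negPf h1) ?(negPf h2) /=;
  rewrite !(inj_eq (@ord_inj m)) in k1 k2 k3 k4 k5 k6;
  by case/or4P => /eqP e; move: k1 k2 k3 k4 k5 k6; rewrite e eqxx.
Qed.

Lemma contraction_nc U : is_triangulation U -> forall i k j l : 'I_m,
  [set i; k] \in contraction U -> [set j; l] \in contraction U ->
  ~~ separates i k j l.
Proof.
move=> triU i k j l /contraction2P[a [c [ac _ <- <-]]] /contraction2P[b [d [bd _ <- <-]]].
apply/negP => /separates_contraction; apply/negP; exact: (tri_nc triU).
Qed.

Let crossed U x y : {set 'I_n * 'I_n} :=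
  [set p | ([set p.1; p.2] \in U) && separates x y p.1 p.2].

(** Edges crossing {u, y} also cross {x, y} by [separates_shift], while {u, v} crosses only the
    latter. This is the decreasing measure for improving a lift of a chord. *)
Lemma crossed_shift U x y u v : is_triangulation U -> [set u; v] \in U ->
  separates x y u v -> #|crossed U u y| < #|crossed U x y|.
Proof.
move=> triU uv s; apply: proper_card; apply/properP; split.
  apply/subsetP => -[p q]; rewrite !inE /= => /andP[pq]; rewrite pq /=.
  rewrite separatesC => s'; rewrite separatesC.
  exact: separates_shift s (tri_nc triU pq uv) s'.
exists (u, v); rewrite !inE /= uv //= /separates.
by rewrite eqxx.
Qed.

Hypothesis f_surj : forall i, exists x, f x = i.

(* A chord crossing no edge of the contraction has a lift to a chord crossing as few
   edges of U as possible; an endpoint of a crossed edge would give a better lift. *)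
Lemma contraction_max U x y : is_triangulation U -> f x != f y ->
  (forall i j, [set i; j] \in contraction U -> ~~ separates (f x) (f y) i j) ->
  [set f x; f y] \in contraction U.
Proof.
move=> triU; have [k] := ubnP #|crossed U x y|.
elim: k x y => // k IHk x y lek ne h.
have [e|[[u v]]] := set_0Vmem (crossed U x y).
  apply: mem_contraction => //; apply: (tri_max triU).
    by apply: contraNneq ne => ->.
  move=> u v uv; apply/negP => s; have := in_set0 (u, v).
  by rewrite -e inE /= uv s.
rewrite inE /= => /andP[uv s].
have vu : [set v; u] \in U by rewrite setUC.
have crossC a b : crossed U a b = crossed U b a.
  by apply/setP => -[p q]; rewrite !inE /= separates_swapl.
case/orP: (f_cyclic s) => [s'|].
  have [_ _ _ _ /andP[_]] := separates_neq s'; rewrite (inj_eq (@ord_inj m)) => nuv.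
  by have := h _ _ (mem_contraction uv nuv); rewrite s'.
have lt z w : #|crossed U z w| < #|crossed U x y| -> #|crossed U z w| < k.
  by move=> lt_zw; apply: leq_trans lt_zw _; rewrite -ltnS.
case/or4P => /eqP e.
- by rewrite e in ne h *; apply: IHk => //; apply: lt; apply: crossed_shift uv _.
- rewrite -e in ne h *; apply: IHk => //; apply: lt; rewrite !(crossC x).
  by apply: crossed_shift uv _; rewrite // separates_swapl.
- rewrite e in ne h *; apply: IHk => //; apply: lt; rewrite !(crossC x).
  by apply: crossed_shift vu _; rewrite // separates_swapl separates_swapr.
rewrite -e in ne h *; apply: IHk => //; apply: lt.
by apply: crossed_shift vu _; rewrite // separates_swapr.
Qed.

Lemma contraction_triangulation U : is_triangulation U ->
  is_triangulation (contraction U).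
Proof.
move=> triU; split; [exact: contraction_card | exact: contraction_nc | ].
move=> i j; have [x <-] := f_surj i; have [y <-] := f_surj j.
exact: contraction_max.
Qed.

(** If a side becomes a point, the image of the new diagonal {b, d} is a point or the image of
    another side, already present in the contraction of U. *)
Lemma quad_flip_collapsedS U V a b c d : quad_flip U V a b c d ->
  collapsed a b c d -> contraction V \subset contraction U.
Proof.
move=> [_ ac [ab bc cd da] ->] col; apply/subsetP => e /contractionP[x [y [xy ne ->]]].
case/setU1P: xy => [/eqP/set2_eqP exy|/setD1P[_]]; last by move/mem_contraction; apply.
have -> : [set f x; f y] = [set f b; f d].
  by case: exy => -[-> ->]; rewrite // setUC.
have {}ne : f b != f d by case: exy ne => -[-> ->]; rewrite // eq_sym.
case/or4P: col => /eqP e1.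
- by rewrite -e1 setUC; apply: mem_contraction => //; rewrite e1 eq_sym.
- by rewrite e1; apply: mem_contraction => //; rewrite -e1.
- by rewrite -e1; apply: mem_contraction => //; rewrite e1.
by rewrite e1 setUC; apply: mem_contraction => //; rewrite -e1 eq_sym.
Qed.

Lemma quad_flip_collapsed U V a b c d : is_triangulation U ->
  quad_flip U V a b c d -> collapsed a b c d -> contraction V = contraction U.
Proof.
move=> triU q col; apply/eqP; rewrite eqEsubset (quad_flip_collapsedS q) //=.
apply: (quad_flip_collapsedS (quad_flip_sym triU q)).
by move: col; rewrite /collapsed orbC -!orbA.
Qed.

(** Removing {a, c} must remove its image from the contraction; this holds because no other edge of
    U has that image. *)
Lemma quad_flip_lift U V a b c d x y : is_triangulation U ->
  quad_flip U V a b c d -> ~~ collapsed a b c d ->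
  [set x; y] \in U -> f x = f a -> f y = f c -> x = a /\ y = c.
Proof.
move=> [_ nc _] [s ac [ab bc cd da] _] col xy xa yc.
have s' : separates (f a) (f c) (f b) (f d) by have := f_cyclic s; rewrite (negPf col) orbF.
have [k1 k2 k3 k4 /andP[k5 k6]] := separates_neq s'.
rewrite !(inj_eq (@ord_inj m)) in k1 k2 k3 k4 k5 k6.
have F z w : f z != f w -> (nat_of_ord z == w) = false.
  by move=> ne; apply: contraNF ne => /eqP/val_inj ->.
have [/andP[/eqP/val_inj-> /eqP/val_inj->] //|/negbTE ne] :=
  boolP ((nat_of_ord x == a) && (nat_of_ord y == c)).
have ne' : [|| nat_of_ord x == b, nat_of_ord x == c, nat_of_ord x == d,
    nat_of_ord y == a, nat_of_ord y == b | nat_of_ord y == d] = false.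
  by rewrite !F ?xa ?yc // eq_sym.
have /or4P[] := separates_lift s (nc _ _ _ _ xy ab) (nc _ _ _ _ xy bc)
   (nc _ _ _ _ xy cd) (nc _ _ _ _ xy da) ne' ne.
all: move/f_cyclic; rewrite /collapsed ?xa ?yc => /orP[/separates_neq[_ _ _ _]|];
  rewrite ?eqxx // => /or4P[] /eqP e; move: k1 k2 k3 k4 k5 k6; by rewrite e eqxx.
Qed.

Lemma quad_flip_contraction U V a b c d : is_triangulation U ->
  quad_flip U V a b c d -> ~~ collapsed a b c d ->
  quad_flip (contraction U) (contraction V) (f a) (f b) (f c) (f d).
Proof.
move=> triU q col; have [s ac [ab bc cd da] eV] := q.
have s' : separates (f a) (f c) (f b) (f d) by have := f_cyclic s; rewrite (negPf col) orbF.
have [k1 k2 k3 k4 /andP[k5 k6]] := separates_neq s'.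
rewrite !(inj_eq (@ord_inj m)) in k1 k2 k3 k4 k5 k6.
split; [by []| exact: mem_contraction | by split; apply: mem_contraction | ].
apply/setP => e; apply/contractionP/setU1P => [[x [y [xy ne ->]]]|].
  move: xy; rewrite eV => /setU1P[/eqP/set2_eqP[[-> ->]|[-> ->]]|/setD1P[nac xy]]; first by left.
    by left; rewrite setUC.
  right; apply/setD1P; split; last exact: mem_contraction.
  apply: contraNneq nac => /eqP/set2_eqP[[e1 e2]|[e1 e2]].
    by have [-> ->] := quad_flip_lift triU q col xy e1 e2.
  rewrite setUC in xy; have [-> ->] := quad_flip_lift triU q col xy e2 e1.
  by rewrite setUC.
case=> [->|/setD1P[ne /contractionP[x [y [xy nxy exy]]]]].
  by exists b, d; rewrite eV setU11.
exists x, y; split=> //; rewrite eV; apply/setU1P; right; apply/setD1P; split=> //.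
apply: contraNneq ne => /eqP/set2_eqP[[e1 e2]|[e1 e2]]; rewrite exy e1 e2 //.
by rewrite setUC.
Qed.

Hypothesis m_gt2 : 2 < m.

Lemma flip_contraction U V : flip (std_polygon n) U V ->
  (contraction U == contraction V)
  || flip (std_polygon m) (contraction U) (contraction V).
Proof.
case/flip_stdP => /triangulation_std[_ triU] [a [b [c [d q]]]].
have [col|col] := boolP (collapsed a b c d).
  by rewrite (quad_flip_collapsed triU q col) eqxx.
apply/orP; right; apply/flip_stdP; split.
  by apply/triangulation_std; split=> //; apply: contraction_triangulation.
by exists (f a), (f b), (f c), (f d); apply: quad_flip_contraction.
Qed.

Lemma contraction_path U s : path (flip (std_polygon n)) U s ->
  exists s', [/\ path (flip (std_polygon m)) (contraction U) s',
    last (contraction U) s' = contraction (last U s)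
    & size s' + collapses U s = size s].
Proof.
elim: s U => [|V s IHs] U /=; first by exists [::].
case/andP => /flip_contraction fUV /IHs[s' [ps' ls' ss']].
have [e|ne] := eqVneq (contraction U) (contraction V).
  by exists s'; rewrite e; split=> //; rewrite -ss' addnCA.
rewrite (negPf ne) /= in fUV; exists (contraction V :: s') => /=.
by rewrite fUV ps' ls'; split=> //; rewrite add0n addSn ss'.
Qed.

Lemma flip_dist_contraction U s : path (flip (std_polygon n)) U s ->
  flip_dist (std_polygon m) (contraction U) (contraction (last U s))
    + collapses U s <= size s.
Proof.
case/contraction_path => s' [ps' ls' <-].
by rewrite leq_add2r; have [_] := flip_distP ps' ls'.
Qed.

(** For contractions that reflect the polygon, the image of the path runs from the plus
    triangulation to the minus one, and has to be reversed. *)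
Lemma flip_dist_contraction_rev U s : path (flip (std_polygon n)) U s ->
  flip_dist (std_polygon m) (contraction (last U s)) (contraction U)
    + collapses U s <= size s.
Proof.
case/contraction_path => s' [ps' ls' <-]; rewrite leq_add2r -ls'.
have := rev_path (flip (std_polygon m)) (contraction U) s'.
rewrite (eq_path (e' := flip (std_polygon m))) ?ps'; last first.
  by move=> W W'; apply/idP/idP; apply: flip_sym.
move/flip_distP => /(_ (contraction U)).
case: (s') => [|W s''] /=; first by case.
by rewrite rev_cons last_rcons size_rcons size_rev size_belast => -[].
Qed.

End Contraction.

(** * Deletions *)

Section Deletion.

Variable T : finType.
Implicit Types (p : seq T) (a b c x y : T) (U : {set {set T}}).

Lemma imset_set2 (T' : finType) (g : T -> T') x y :
  [set g z | z in [set x; y]] = [set g x; g y].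
Proof. by rewrite imsetU !imset_set1. Qed.

Lemma deletion_card p U a : (forall e, e \in U -> #|e| = 2) ->
  forall e, e \in deletion p U a -> #|e| = 2.
Proof.
move=> U2 e /imsetP[e0 /setD1P[ne e0U] ->].
have /eqP/cards2P[u [v [uv e_uv]]] := U2 _ e0U; rewrite e_uv in ne *.
rewrite imset_set2 cards2; case: eqP => // e1; case/eqP: ne; move: e1.
have [ua|ua] := eqVneq u a; have [va|va] := eqVneq v a => // e1.
- by rewrite ua va eqxx in uv.
- by rewrite -e1 ua.
- by rewrite e1 va setUC.
by rewrite e1 eqxx in uv.
Qed.

Lemma mem_deletion p U a x y : (forall e, e \in U -> #|e| = 2) ->
  x != a -> y != a -> x != y ->
  ([set x; y] \in deletion p U a) =
  [|| [set x; y] \in U, (x == next p a) && ([set a; y] \in U)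
    | (y == next p a) && ([set a; x] \in U)].
Proof.
move=> U2 xa ya xy; set b := next p a; apply/imsetP/idP.
  case=> e0 /setD1P[ne e0U].
  have /eqP/cards2P[u [v [uv e_uv]]] := U2 _ e0U; rewrite e_uv in ne e0U *.
  have key z w : z != w -> [set z; w] \in U -> x = (if z == a then b else z) ->
      y = (if w == a then b else w) ->
      [|| [set x; y] \in U, (x == b) && ([set a; y] \in U) | (y == b) && ([set a; x] \in U)].
    have [->|_] := eqVneq z a; have [->|_] := eqVneq w a; rewrite ?eqxx // => _ zw -> ->.
    - by rewrite zw eqxx orbT.
    - by rewrite [ [set a; z] ]setUC zw eqxx !orbT.
    by rewrite zw.
  rewrite imset_set2 -/b => /eqP/set2_eqP[[h1 h2]|[h1 h2]]; first exact: key e0U h1 h2.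
  by apply: (key v u); rewrite // 1?eq_sym // setUC.
have na z w : z != a -> w != a -> [set z; w] != [set a; b].
  by move=> za wa; apply/set2_eqP => -[[e _]|[_ e]]; subst; rewrite eqxx in za wa.
case/or3P => [h|/andP[/eqP xb h]|/andP[/eqP yb h]].
- exists [set x; y]; first by apply/setD1P; split=> //; apply: na.
  by rewrite imset_set2 (negPf xa) (negPf ya).
- exists [set a; y]; last by rewrite imset_set2 eqxx (negPf ya) xb.
  apply/setD1P; split=> //; apply/set2_eqP => -[[_ e]|[_ e]]; first by rewrite xb e eqxx in xy.
  by rewrite e eqxx in ya.
exists [set a; x]; last by rewrite imset_set2 eqxx (negPf xa) yb setUC.
apply/setD1P; split=> //; apply/set2_eqP => -[[_ e]|[_ e]]; first by rewrite yb e eqxx in xy.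
by rewrite e eqxx in xa.
Qed.

(** Edges at a are moved to b by the first deletion and then, with those of b, to c. As x and y
    avoid a and b, the intermediate position is never seen. *)
Lemma mem_deletion2 p U a b c x y : (forall e, e \in U -> #|e| = 2) ->
  next p a = b -> next (rem a p) b = c -> a != b ->
  x != a -> y != a -> x != b -> y != b -> x != y ->
  ([set x; y] \in deletion (rem a p) (deletion p U a) b) =
  [|| [set x; y] \in U,
      (x == c) && (([set a; y] \in U) || ([set b; y] \in U))
    | (y == c) && (([set a; x] \in U) || ([set b; x] \in U))].
Proof.
move=> U2 pa pb ab xa ya xb yb xy.
have ba : b != a by rewrite eq_sym.
have bx : b != x by rewrite eq_sym.
have b_y : b != y by rewrite eq_sym.
rewrite (mem_deletion _ (deletion_card U2)) // pb !mem_deletion // pa.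
rewrite (negPf xb) (negPf yb) eqxx /= !orbF.
by rewrite ![([set b; _] \in U) || _]orbC.
Qed.

End Deletion.

Section Next.

Variable N : nat.
Implicit Types (p : seq 'I_N) (a b : 'I_N).

Lemma next_filter (Q : pred 'I_N) a b : Q a -> Q b -> a < b ->
  (forall z : 'I_N, a < z -> z < b -> ~~ Q z) -> next [seq z <- enum 'I_N | Q z] a = b.
Proof.
move=> Qa Qb ab none; set p := filter Q _.
have srt : sorted (fun x y : 'I_N => x < y) p.
  apply: sorted_filter; first by move=> x y z; apply: ltn_trans.
  by have := iota_ltn_sorted 0 N; rewrite -val_enum_ord sorted_map.
have pa : a \in p by rewrite mem_filter Qa mem_enum.
have pb : b \in p by rewrite mem_filter Qb mem_enum.
have up : uniq p by rewrite filter_uniq ?enum_uniq.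
have inQ z : z \in p -> Q z by rewrite mem_filter => /andP[].
rewrite next_nth pa; case/splitPr: pa pb up srt inQ => p1 p2 pb up srt inQ.
have ap1 : a \notin p1 by move: up; rewrite cat_uniq /= negb_or => /and3P[_ /andP[]].
move: srt; rewrite sorted_pairwise; last by move=> x y z; apply: ltn_trans.
rewrite pairwise_cat pairwise_cons => /and3P[/allrelP r12 _ /andP[/allP r2 r22]].
have bp2 : b \in p2.
  move: pb; rewrite mem_cat inE => /or3P[bp1|/eqP eba|//].
    by have := r12 b a bp1 (mem_head _ _); rewrite ltnNge ltnW.
  by rewrite eba ltnn in ab.
case: p2 => [//|c p2] in up r12 r2 r22 bp2 inQ pb *.
have <- : c = b.
  move: bp2; rewrite inE => /predU1P[//|bp2].
  have cb : c < b by move: r22; rewrite pairwise_cons => /andP[/allP/(_ _ bp2)].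
  have := none c (r2 c (mem_head _ _)) cb.
  by rewrite inQ // mem_cat !inE eqxx !orbT.
rewrite index_cat (negPf ap1) /= eqxx addn0.
by case: (p1) => [|d q] //=; rewrite nth_cat ltnNge leqnSn /= subSnn.
Qed.

Lemma next_filter_last (Q : pred 'I_N) a b : Q a -> Q b ->
  (forall z : 'I_N, Q z -> b <= z <= a) -> next [seq z <- enum 'I_N | Q z] a = b.
Proof.
move=> Qa Qb all_ba; set p := filter Q _.
have srt : sorted (fun x y : 'I_N => x < y) p.
  apply: sorted_filter; first by move=> x y z; apply: ltn_trans.
  by have := iota_ltn_sorted 0 N; rewrite -val_enum_ord sorted_map.
have pa : a \in p by rewrite mem_filter Qa mem_enum.
have pb : b \in p by rewrite mem_filter Qb mem_enum.
have up : uniq p by rewrite filter_uniq ?enum_uniq.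
have inQ z : z \in p -> b <= z <= a by rewrite mem_filter => /andP[/all_ba].
rewrite next_nth pa; case/splitPr: pa pb up srt inQ => p1 p2 pb up srt inQ.
have ap1 : a \notin p1 by move: up; rewrite cat_uniq /= negb_or => /and3P[_ /andP[]].
move: srt; rewrite sorted_pairwise; last by move=> x y z; apply: ltn_trans.
rewrite pairwise_cat pairwise_cons => /and3P[/allrelP r12 r1 /andP[/allP r2 r22]].
have e2 : p2 = [::].
  case: p2 => [//|c p2] in up r12 r2 r22 inQ pb *.
  have /andP[_ ca] : b <= c <= a by apply: inQ; rewrite mem_cat !inE eqxx !orbT.
  by have := r2 c (mem_head _ _); rewrite ltnNge ca.
rewrite {p2}e2 in up r12 r2 r22 inQ pb *.
rewrite index_cat (negPf ap1) /= eqxx addn0.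
case: p1 => [|d q] /= in up ap1 r12 r1 inQ pb *; first by move: pb; rewrite inE => /eqP.
rewrite nth_default ?size_cat ?addn1 //.
move: pb; rewrite inE mem_cat inE => /or3P[/eqP -> //|bq|/eqP eb].
  move: r1 => /andP[/allP/(_ _ bq) db _].
  by have /andP[] := inQ d (mem_head _ _); rewrite leqNgt db.
have := r12 d a (mem_head _ _) (mem_head _ _); rewrite -eb => db.
by have /andP[] := inQ d (mem_head _ _); rewrite leqNgt db.
Qed.

Lemma rem_filter_enum (Q : pred 'I_N) a :
  rem a [seq z <- enum 'I_N | Q z] = [seq z <- enum 'I_N | Q z && (z != a)].
Proof.
have u : uniq [seq z <- enum 'I_N | Q z] by rewrite filter_uniq ?enum_uniq.
by rewrite (rem_filter _ u); elim: (enum 'I_N) => //= z s <-; case: (Q z).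
Qed.

Lemma iter_next p (f : nat -> 'I_N) n t k : 0 < n ->
  (forall i, i.+1 < n -> next p (f i) = f i.+1) -> next p (f n.-1) = f 0 ->
  t < n -> iter k (next p) (f t) = f ((t + k) %% n).
Proof.
move=> n0 fS fn tn; elim: k => [|k IHk]; first by rewrite addn0 modn_small.
have -> : (t + k.+1) %% n = ((t + k) %% n).+1 %% n by rewrite -[in RHS]addn1 modnDml addn1 addnS.
rewrite iterS IHk; have := ltn_pmod (t + k) n0; rewrite leq_eqVlt => /predU1P[e|lt].
  by rewrite e modnn -fn; congr (next p (f _)); rewrite -[in RHS]e.
by rewrite (modn_small lt) fS.
Qed.

End Next.

(** * Zigzags *)

Lemma next_std N (v : 'I_N) :
  next (std_polygon N) v = (if v.+1 < N then v.+1 else 0) :> nat.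
Proof.
rewrite /std_polygon -[enum _]filter_predT.
case: ifP => [lt|/negbT]; last rewrite -leqNgt => ge.
  rewrite (@next_filter _ predT v (Ordinal lt)) //= => z; lia.
have N0 : 0 < N by case: N v {ge} => [[]|].
rewrite (@next_filter_last _ predT v (Ordinal N0)) //= => z _.
have := ltn_ord z; lia.
Qed.

Section ZigzagValues.
Import GRing.Theory.
Local Open Scope ring_scope.

Lemma val_natr n k : (k < n.+4)%N -> (k%:R : 'I_n.+4) = k :> nat.
Proof. by move=> lt; rewrite Zp_nat /= modn_small. Qed.

Lemma val_natrB n c k : (c < n.+4)%N -> (k < n.+4)%N ->
  (c%:R - k%:R : 'I_n.+4) = (if (k <= c)%N then (c - k)%N else (n.+4 + c - k)%N) :> nat.
Proof.
move=> hc hk.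
have -> : val (c%:R - k%:R : 'I_n.+4) =
  ((val (c%:R : 'I_n.+4) + (n.+4 - val (k%:R : 'I_n.+4)) %% n.+4) %% n.+4)%N by [].
rewrite /= !val_natr //; case: k hk => [|k] hk.
  by rewrite subn0 modnn addn0 modn_small // subn0.
rewrite [((n.+4 - k.+1) %% _)%N]modn_small; last by lia.
case: ifP => h; last by rewrite modn_small; move: h; lia.
have -> : (c + (n.+4 - k.+1) = n.+4 + (c - k.+1))%N by lia.
by rewrite modnDl modn_small //; lia.
Qed.

Lemma val_natrD n c k : (c + k < n.+4)%N ->
  (c%:R + k%:R : 'I_n.+4) = (c + k)%N :> nat.
Proof. by move=> h; rewrite -natrD val_natr. Qed.

Lemma zigzag_edgeP n j : (0 < n)%N -> (j < n.+1)%N ->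
  exists x y : 'I_n.+4, [/\ zigzag_edge n j.+1 = [set x; y], (y = 4 + j./2 :> nat)%N
    & (x = (if (j./2 + odd j <= 2) then 2 - j./2 - odd j else n.+4 + 2 - j./2 - odd j) :> nat)%N].
Proof.
move=> n0 hj; have hd := odd_double_half j; rewrite -muln2 in hd.
rewrite /zigzag_edge oddS /=; case: ifP => od.
  exists (2%:R - (j./2)%:R), (4%:R + (j./2)%:R); split=> //.
    by rewrite val_natrD //; lia.
  by rewrite (negPf od) addn0 !subn0 in hd *; rewrite val_natrB; try lia.
exists (1%:R - (j./2)%:R), (4%:R + (j./2)%:R); split=> //.
  by rewrite val_natrD //; lia.
move/negbFE: od => od; rewrite od in hd *.
by rewrite val_natrB; try lia; do 2 case: ifP; lia.
Qed.

End ZigzagValues.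

(** Besides the boundary edges: the ends of the zigzag edges {2-k, 4+k} and {1-k, 4+k} have sums 6
    and 5 modulo N, and conversely every pair of distinct vertices with such a sum is an edge. The
    condition [x != y] excludes the degenerate solutions such as x = y = 3. *)
Definition zigzag_rel (N x y : nat) : bool :=
  (x != y) && [|| y == x.+1, x == y.+1, (x == 0) && (y.+1 == N), (y == 0) && (x.+1 == N),
    x + y == 5, x + y == 6, x + y == N + 5 | x + y == N + 6].

Lemma zigzag_relC N x y : zigzag_rel N x y = zigzag_rel N y x.
Proof. rewrite /zigzag_rel; lia. Qed.

Lemma zigzag_pair n (e : {set 'I_n.+4}) : 0 < n -> e \in zigzag n ->
  exists x y, e = [set x; y] /\ zigzag_rel n.+4 x y.
Proof.
move=> n0 /setUP[/imsetP[v _ ->]|/imsetP[[j hj] _ ->]].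
  exists v, (next (std_polygon n.+4) v); split=> //.
  by rewrite /zigzag_rel next_std; have := ltn_ord v; case: ifP; lia.
have [x [y [-> ey ex]]] := zigzag_edgeP n0 hj; exists x, y; split=> //.
have hd := odd_double_half j; rewrite -muln2 in hd.
by rewrite /zigzag_rel ex ey; case: ifP; lia.
Qed.

Lemma zigzag_card n (e : {set 'I_n.+4}) : 0 < n -> e \in zigzag n -> #|e| = 2.
Proof.
move=> n0 /(zigzag_pair n0)[x [y [-> /andP[ne _]]]].
by rewrite cards2 -(inj_eq (@ord_inj _)) ne.
Qed.

Lemma mem_zigzag n (x y : 'I_n.+4) : 0 < n ->
  ([set x; y] \in zigzag n) = zigzag_rel n.+4 x y.
Proof.
move=> n0; apply/idP/idP.
  case/(zigzag_pair n0) => u [v [/eqP/set2_eqP[[-> ->]|[-> ->]]]] //.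
  by rewrite zigzag_relC.
have bnd (u v : 'I_n.+4) : (v == u.+1 :> nat) || (u.+1 == n.+4) && (v == 0 :> nat) ->
    [set u; v] \in zigzag n.
  move=> h; apply/setUP; left; apply/imsetP; exists u; first by rewrite mem_enum.
  congr [set u; _]; apply: ord_inj; rewrite next_std; have := ltn_ord v; case: ifP h; lia.
have zz (u v : 'I_n.+4) (o : bool) k : o + k.*2 < n.+1 -> v = 4 + k :> nat ->
    u = (if k + o <= 2 then 2 - k - o else n.+4 + 2 - k - o) :> nat ->
    [set u; v] \in zigzag n.
  move=> hj hv hu; apply/setUP; right; apply/imsetP; exists (Ordinal hj) => //.
  have [x' [y' [-> ey ex]]] := zigzag_edgeP n0 hj.
  rewrite half_bit_double oddD odd_double addbF oddb in ey ex.
  by congr [set _; _]; apply: ord_inj; rewrite ?hv ?hu.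
wlog : x y / x <= y.
  move=> w; case/orP: (leq_total x y) => [|h]; first exact: w.
  by rewrite zigzag_relC setUC; apply: w.
move=> le_xy; have hx := ltn_ord x; have hy := ltn_ord y.
have [adj|] := boolP (y == x.+1 :> nat); first by move=> _; apply: bnd; rewrite adj.
have [adj|] := boolP ((y.+1 == n.+4) && (x == 0 :> nat)).
  by move=> _ _; rewrite setUC; apply: bnd; rewrite adj orbT.
move=> n1 n2; rewrite /zigzag_rel => /andP[ne h].
have [s5|n5] := eqVneq (x + y) 5.
  by apply: (zz _ _ true (y - 4)); rewrite -?muln2 /=; try case: ifP; move: n1 n2 h;
    rewrite ?negb_and; lia.
have [s6|n6] := eqVneq (x + y) 6.
  by apply: (zz _ _ false (y - 4)); rewrite -?muln2 /=; try case: ifP; move: n1 n2 h;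
    rewrite ?negb_and; lia.
rewrite setUC; have [s5'|n5'] := eqVneq (x + y) (n.+4 + 5).
  by apply: (zz _ _ true (x - 4)); rewrite -?muln2 /=; try case: ifP; move: n1 n2 h;
    rewrite ?negb_and; lia.
by apply: (zz _ _ false (x - 4)); rewrite -?muln2 /=; try case: ifP; move: n1 n2 h;
  rewrite ?negb_and; lia.
Qed.

(** The right-hand side of [mem_deletion2], for edges given by a relation on labels. *)
Definition merge2_rel (R : rel nat) a b c : rel nat := fun x y =>
  [|| R x y, (x == c) && (R a y || R b y) | (y == c) && (R a x || R b x)].

Section TwoMerges.

Variables (n : nat) (a0 a1 b0 b1 : 'I_n.+4).

Let kept (z : 'I_n.+4) := [&& z != a0, z != a1, z != b0 & z != b1].
Let result := delete_seq (std_polygon n.+4) (zigzag n) [:: a0; a1; b0; b1].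

Lemma merged_polygon : result.1 = [seq z <- enum 'I_n.+4 | kept z].
Proof.
rewrite /result /= /std_polygon -[enum 'I_n.+4]filter_predT !rem_filter_enum.
by rewrite filter_predT; apply: eq_filter => z; rewrite /kept /= -!andbA.
Qed.

Lemma merged_card e : 0 < n -> e \in result.2 -> #|e| = 2.
Proof. by move=> n_gt0; do 4 apply: deletion_card => //; move=> e'; apply: zigzag_card. Qed.

Lemma merged_labelled (f : nat -> 'I_n.+4) t l (i : 'I_n) : 0 < n ->
  (forall k, k < n -> kept (f k)) ->
  (forall k k', k < k' < n -> f k < f k') ->
  (forall z, kept z -> exists2 k, k < n & z = f k) ->
  t < n -> labelled result.1 (f t) l i = f ((t + (i + (n - l))) %% n).
Proof.
move=> n0 fk mono fsurj tn; rewrite /labelled merged_polygon.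
apply: iter_next => // [k hk|].
  apply: next_filter; [by apply: fk; lia|by apply: fk; lia|by apply: mono; lia|].
  move=> z h1 h2; apply/negP => /fsurj[k' hk' ez]; rewrite {z}ez in h1 h2.
  have [lt|lt|e] := ltngtP k' k; last by rewrite e ltnn in h1.
    by have := mono k' k; lia.
  have [e|ne] := eqVneq k' k.+1; first by rewrite e ltnn in h2.
  by have := mono k.+1 k'; lia.
apply: next_filter_last; [by apply: fk; lia|by apply: fk; lia|].
move=> z /fsurj[k hk ->]; apply/andP; split.
  by case: k hk => [|k] hk //; apply/ltnW/mono.
have [->//|ne] := eqVneq k n.-1; apply/ltnW/mono; lia.
Qed.

Variables a2 c : 'I_n.+4.
Hypotheses (n_gt0 : 0 < n) (ea1 : a1 = a0.+1 :> nat) (ea2 : a2 = a1.+1 :> nat).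
Hypotheses (lt_ab : a2 < b0) (eb1 : b1 = b0.+1 :> nat).
(** The second branch is the wrap-around, where the successor of [b1] is 0; [0 < a0] ensures that 0
    has not been deleted. *)
Hypothesis ec : if b1.+1 < n.+4 then c = b1.+1 :> nat else 0 < a0 /\ c = 0 :> nat.

Lemma mem_merged x y : kept x -> kept y -> x != y -> ([set x; y] \in result.2) =
  merge2_rel (merge2_rel (zigzag_rel n.+4) a0 a1 a2) b0 b1 c x y.
Proof.
have ordE (u v : 'I_n.+4) : (u == v) = (u == v :> nat) by [].
rewrite /kept !ordE => /and4P[x1 x2 x3 x4] /and4P[y1 y2 y3 y4] xy.
rewrite /result /delete_seq /delete_step /=.
set p := std_polygon _; set p2 := rem a1 (rem a0 p).
have p_filter : p = [seq z <- enum 'I_n.+4 | predT z] by rewrite filter_predT.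
have rem_a0 : rem a0 p = [seq z <- enum 'I_n.+4 | predT z && (z != a0)].
  by rewrite p_filter rem_filter_enum.
have p2_filter : p2 = [seq z <- enum 'I_n.+4 | predT z && (z != a0) && (z != a1)].
  by rewrite /p2 rem_a0 rem_filter_enum.
have next_a0 : next p a0 = a1.
  by rewrite p_filter; apply: next_filter => // [|z]; rewrite ?ea1 //; lia.
have next_a1 : next (rem a0 p) a1 = a2.
  rewrite rem_a0; apply: next_filter; rewrite /= ?ordE; try (move=> z; rewrite ?ordE); lia.
have next_b0 : next p2 b0 = b1.
  rewrite p2_filter; apply: next_filter; rewrite /= ?ordE; try (move=> z; rewrite ?ordE); lia.
have next_b1 : next (rem b0 p2) b1 = c.
  rewrite p2_filter rem_filter_enum; move: ec; case: ifP => [lt ec'|ge [a_gt0 ec']].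
    apply: next_filter; rewrite /= ?ordE; try (move=> z; rewrite ?ordE); lia.
  apply: next_filter_last; rewrite /= ?ordE;
    try (move=> z; rewrite ?ordE; have := ltn_ord z); lia.
have Z2 e : e \in zigzag n -> #|e| = 2 by exact: zigzag_card.
set U2 := deletion (rem a0 p) (deletion p (zigzag n) a0) a1.
have U22 e : e \in U2 -> #|e| = 2 by do 2 apply: deletion_card => //.
have U2E (u v : 'I_n.+4) : u != a0 -> u != a1 -> v != a0 -> v != a1 -> u != v ->
    ([set u; v] \in U2) = merge2_rel (zigzag_rel n.+4) a0 a1 a2 u v.
  move=> u1 u2 v1 v2 uv; rewrite (mem_deletion2 Z2 next_a0 next_a1) //; last by rewrite ordE; lia.
  by rewrite !mem_zigzag.
rewrite (mem_deletion2 U22 next_b0 next_b1) //; last by rewrite ordE; lia.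
by rewrite !U2E // ordE; lia.
Qed.

End TwoMerges.

(** * The edges of A_n^- and A_n^+ *)

(* The edges {i, j}, i < j, of A_n^- and A_n^+, where h is the floor of (n + 4) / 2. *)
Definition minus_rel (n h i j : nat) : bool :=
  [|| j == i.+1, (i == 0) && (j.+1 == n),
      [&& i <= 2, j <= h & (i + j == 7) || (i + j == 8)], (i == 2) && (j == 4),
      (i <= h) && ((i + j == n + 7) || (i + j == n + 8)),
      (i == h) && ((j == h + 2) || (j == h + 3))
    | (j == h) && ((i + n == h + 2) || (i + n == h + 3))].

Definition plus_rel (n h i j : nat) : bool :=
  [|| j == i.+1, (i == 0) && (j.+1 == n),
      [&& 3 <= i, h < j & (i + j == n + 1) || (i + j == n + 2)], (j == 3) && (i <= 1)
    | (j == h.+1) && ((i.+1 == h) || (i.+2 == h))].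

(** The vertex of the (n+4)-gon that receives the label i. As 0 and 1 are deleted and 2 keeps its
    label, the labels 0 and 1 go to the last two vertices; in [plus_label], where 2 gets the label
    1, the vertex 0 gets the last label. *)
Definition minus_label (n h i : nat) : nat :=
  if i < 2 then n + 2 + i else if i < h then i else i + 2.

Definition plus_label (n h i : nat) : nat :=
  if i.+1 == n then 0 else if i < 3 then i.+1 else if i <= h then i + 3 else i + 5.

Ltac decide_atoms := repeat (match goal with
  | |- context [@eq_op _ ?a ?b] =>
     first [rewrite (_ : (a == b) = false); [|by lia] | rewrite (_ : (a == b) = true); [|by lia]
           | case: (eqVneq a b) => ?]
  | |- context [leq ?a ?b] =>
     first [rewrite (_ : (a <= b) = false); [|by lia] | rewrite (_ : (a <= b) = true); [|by lia]
           | case: (leqP a b) => ?]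
  end; rewrite ?andbF ?andbT ?orbF ?orbT /=); try by [].

Lemma minus_relE n h i j : 6 < n -> n + 3 <= h.*2 <= n + 4 -> i < j < n ->
  merge2_rel (merge2_rel (zigzag_rel n.+4) 0 1 2) h h.+1 h.+2
    (minus_label n h i) (minus_label n h j) = minus_rel n h i j.
Proof.
rewrite -muln2 => n7 hh ij.
rewrite /merge2_rel /minus_rel.
have x2 k : (minus_label n h k == 2) = (k == 2).
  by rewrite /minus_label; do ?[case: ifP => ?]; lia.
have xh k : (minus_label n h k == h.+2) = (k == h) \/ n <= k.
  by rewrite /minus_label; do ?[case: ifP => ?]; lia.
have h2 : ((h == 2) = false) * ((h.+1 == 2) = false) by split; lia.
have [ih|?] := xh i; [|exfalso; lia]; have [jh|?] := xh j; [|exfalso; lia].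
rewrite !x2 ih jh !h2 /=; move: {x2 xh ih jh h2} n7 hh ij => n7 hh ij.
have lab k : k < n ->
   [\/ [/\ k < 2, (k == 2) = false, (k == h) = false & minus_label n h k = n + 2 + k],
   [/\ k = 2, (k == 2) = true, (k == h) = false & minus_label n h k = 2],
   [/\ 2 < k < h, (k == 2) = false, (k == h) = false & minus_label n h k = k]
   | (k = h /\ [/\ (k == 2) = false, (k == h) = true & minus_label n h k = h + 2])
   \/ [/\ h < k, (k == 2) = false, (k == h) = false & minus_label n h k = k + 2]].
  move=> _; rewrite /minus_label; case: (ltngtP k 2) => k2; last 1 first.
  - by apply: Or42; rewrite k2; split=> //; do ?[case: ifP => ?]; lia.
  - by apply: Or41; split; lia.
  case: (ltngtP k h) => kh; first by apply: Or43; split; lia.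
    by apply: Or44; right; split; lia.
  by apply: Or44; left; split; last split; lia.
have hj : j < n by lia.
have hi : i < n by lia.
case: (lab i hi) => [[si -> -> ->]|[si -> -> ->]|[si -> -> ->]|[[si [-> -> ->]]|[si -> -> ->]]];
case: (lab j hj) => [[sj -> -> ->]|[sj -> -> ->]|[sj -> -> ->]|[[sj [-> -> ->]]|[sj -> -> ->]]];
  try (by exfalso; lia); rewrite ?orbF /=; rewrite /zigzag_rel {lab hi hj}; decide_atoms.
Qed.

(** The successor of the deleted vertex h + 5. With h the floor of (n + 4) / 2 and n > 6, it wraps
    around only for n = 7 and n = 8, sizes that do occur as n - 5 or n - 6 in the final bound. *)
Definition plus_merge (n h : nat) : nat := if h + 6 < n.+4 then h + 6 else 0.

Lemma plus_relE n h i j : 6 < n -> n + 3 <= h.*2 <= n + 4 -> i < j < n ->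
  merge2_rel (merge2_rel (zigzag_rel n.+4) 4 5 6) (h + 4) (h + 5) (plus_merge n h)
    (plus_label n h i) (plus_label n h j) = plus_rel n h i j.
Proof.
rewrite -muln2 => n7 hh ij.
rewrite /merge2_rel /plus_rel.
have h6 : ((h + 4 == 6) = false) * ((h + 5 == 6) = false) by split; lia.
rewrite !h6 /= {h6}.
have lab k : k < n ->
   [\/ [/\ k < 3, (plus_label n h k == 6) = false,
           (plus_label n h k == plus_merge n h) = false & plus_label n h k = k.+1],
   [/\ k = 3, (plus_label n h k == 6) = true,
           (plus_label n h k == plus_merge n h) = false & plus_label n h k = 6],
   [/\ 3 < k <= h, (plus_label n h k == 6) = false,
           (plus_label n h k == plus_merge n h) = false & plus_label n h k = k + 3]
   | [/\ k = h.+1, (plus_label n h k == 6) = false,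
         (plus_label n h k == plus_merge n h) = true & plus_label n h k = plus_merge n h]
   \/ [/\ h.+1 < k, (plus_label n h k == 6) = false,
         (plus_label n h k == plus_merge n h) = false &
         plus_label n h k = if k.+1 == n then 0 else k + 5]].
  move=> kn; rewrite /plus_label /plus_merge; case: (ltngtP k 3) => k3; last 1 first.
  - by apply: Or42; rewrite k3; split=> //; do ?[case: ifP => ?]; lia.
  - by apply: Or41; split; do ?[case: ifP => ?]; lia.
  case: (ltngtP k h.+1) => kh; first by apply: Or43; split; do ?[case: ifP => ?]; lia.
    by apply: Or44; right; split; do ?[case: ifP => ?]; lia.
  by apply: Or44; left; split; do ?[case: ifP => ?]; lia.
have hj : j < n by lia.
have hi : i < n by lia.
case: (lab i hi) => [[si -> -> ->]|[si -> -> ->]|[si -> -> ->]|[[si -> -> ->]|[si -> -> ->]]];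
case: (lab j hj) => [[sj -> -> ->]|[sj -> -> ->]|[sj -> -> ->]|[[sj -> -> ->]|[sj -> -> ->]]];
  try (by exfalso; lia); rewrite ?orbF /=; rewrite /zigzag_rel /plus_merge {lab hi hj};
  do ?[case: ifP => ?]; decide_atoms.
Qed.

Section Labels.
Import GRing.Theory.
Local Open Scope ring_scope.

Variable n : nat.
Hypothesis n_gt6 : (6 < n)%N.
Let h := (n./2 + 2)%N.

(** The floor is replaced by linear bounds, so that [lia] treats both parities of n at once. *)
Lemma half_bounds : (n + 3 <= h.*2 <= n + 4)%N.
Proof. by rewrite /h; have := odd_double_half n; rewrite -!muln2; lia. Qed.

Lemma val_opp_vertex k : (k <= 5)%N -> (k + h < n.+4)%N -> opp_vertex n k = (h + k)%N :> nat.
Proof. by move=> k5 lt; rewrite /opp_vertex val_natrD /=; rewrite /h in lt *; lia. Qed.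

Let minus_result := delete_seq (std_polygon n.+4) (zigzag n)
  [:: 0%:R; 1%:R; opp_vertex n 0; opp_vertex n 1].
Let plus_result := delete_seq (std_polygon n.+4) (zigzag n)
  [:: 4%:R; 5%:R; opp_vertex n 4; opp_vertex n 5].

Lemma minus_labelled (i : 'I_n) :
  labelled minus_result.1 (2%:R : 'I_n.+4) 2 i = minus_label n h i :> nat.
Proof.
have hh := half_bounds; rewrite -muln2 in hh.
pose f t : 'I_n.+4 := inord (if (t < h - 2)%N then t + 2 else t + 4)%N.
have fE t : (t < n)%N -> f t = (if (t < h - 2)%N then t + 2 else t + 4)%N :> nat.
  by move=> tn; rewrite inordK //; case: ifP; lia.
have -> : (2%:R : 'I_n.+4) = f 0%N by apply: ord_inj; rewrite val_natr // fE; try case: ifP; lia.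
have e0 := val_natr (isT : (0 < n.+4)%N); have e1 := val_natr (isT : (1 < n.+4)%N).
have e2 : opp_vertex n 0 = h :> nat by rewrite val_opp_vertex; lia.
have e3 : opp_vertex n 1 = (h + 1)%N :> nat by rewrite val_opp_vertex; lia.
have keptE (z : 'I_n.+4) : [&& z != 0%:R, z != 1%:R, z != opp_vertex n 0 & z != opp_vertex n 1]
    = [&& z != 0 :> nat, z != 1 :> nat, z != h :> nat & z != h + 1 :> nat]%N.
  by rewrite -!(inj_eq (@ord_inj _)) e0 e1 e2 e3.
rewrite merged_labelled; try lia.
- rewrite /minus_label; have hi := ltn_ord i; case: (ltnP i 2) => i2.
    by rewrite modn_small ?fE; do ?[case: ifP => ?]; lia.
  have -> : (0 + (i + (n - 2)) = n + (i - 2))%N by lia.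
  by rewrite modnDl modn_small ?fE; do ?[case: ifP => ?]; lia.
- by move=> k hk; rewrite keptE fE //; case: ifP; lia.
- by move=> k k' hk; rewrite !fE; try lia; do ?[case: ifP => ?]; lia.
move=> z; rewrite keptE => hz; have hz' := ltn_ord z; case: (ltnP z h) => zh.
  by exists (z - 2)%N; [lia | apply: ord_inj; rewrite fE; do ?[case: ifP => ?]; lia].
by exists (z - 4)%N; [lia | apply: ord_inj; rewrite fE; do ?[case: ifP => ?]; lia].
Qed.

Lemma A_minusP (i j : 'I_n) : (i < j)%N ->
  ([set i; j] \in A_minus n) = minus_rel n h i j.
Proof.
have hh := half_bounds; move=> ij; rewrite -minus_relE //; last by have := ltn_ord j; lia.
rewrite /A_minus inE imset_set2 -/minus_result; rewrite -muln2 in hh.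
have e0 := val_natr (isT : (0 < n.+4)%N); have e1 := val_natr (isT : (1 < n.+4)%N).
have e2' := val_natr (isT : (2 < n.+4)%N).
have e2 : opp_vertex n 0 = h :> nat by rewrite val_opp_vertex; lia.
have e3 : opp_vertex n 1 = h.+1 :> nat by rewrite val_opp_vertex; lia.
have lt_c : (h.+2 < n.+4)%N by lia.
have hj := ltn_ord j.
have := minus_labelled i; have := minus_labelled j.
move: (labelled _ _ _ i) (labelled _ _ _ j) => x y ey ex.
rewrite (@mem_merged n 0%:R 1%:R (opp_vertex n 0) (opp_vertex n 1) 2%:R (Ordinal lt_c)).
all: rewrite -?(inj_eq (@ord_inj _)) ?ex ?ey ?e0 ?e1 ?e2' ?e2 ?e3 ?lt_c //; try lia.
all: by rewrite /minus_label; do ?[case: ifP => ?]; lia.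
Qed.

Lemma A_minus_card (e : {set 'I_n}) : e \in A_minus n -> #|e| = 2.
Proof.
rewrite /A_minus inE -/minus_result => /merged_card.
rewrite card_imset; first by apply; lia.
move=> i j /(congr1 (@nat_of_ord _)); rewrite !minus_labelled /minus_label => eq_ij; apply: ord_inj.
have hh := half_bounds; rewrite -muln2 in hh.
by have := ltn_ord i; have := ltn_ord j; move: eq_ij; do ?[case: ifP => ?]; lia.
Qed.

Lemma plus_labelled (i : 'I_n) :
  labelled plus_result.1 (2%:R : 'I_n.+4) 1 i = plus_label n h i :> nat.
Proof.
have hh := half_bounds; rewrite -muln2 in hh.
pose f t : 'I_n.+4 := inord (if (t < 4)%N then t else if (t < h + 2)%N then t + 2 else t + 4)%N.
have fE t : (t < n)%N ->
    f t = (if (t < 4)%N then t else if (t < h + 2)%N then t + 2 else t + 4)%N :> nat.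
  by move=> tn; rewrite inordK //; do ?[case: ifP => ?]; lia.
have -> : (2%:R : 'I_n.+4) = f 2%N.
  by apply: ord_inj; rewrite val_natr // fE //; lia.
have e0 : (4%:R : 'I_n.+4) = 4 :> nat by rewrite val_natr; lia.
have e1 : (5%:R : 'I_n.+4) = 5 :> nat by rewrite val_natr; lia.
have e2 : opp_vertex n 4 = (h + 4)%N :> nat by rewrite val_opp_vertex; lia.
have e3 : opp_vertex n 5 = (h + 5)%N :> nat by rewrite val_opp_vertex; lia.
have keptE (z : 'I_n.+4) : [&& z != 4%:R, z != 5%:R, z != opp_vertex n 4 & z != opp_vertex n 5]
    = [&& z != 4 :> nat, z != 5 :> nat, z != h + 4 :> nat & z != h + 5 :> nat]%N.
  by rewrite -!(inj_eq (@ord_inj _)) e0 e1 e2 e3.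
rewrite merged_labelled; try lia.
- rewrite /plus_label; have hi := ltn_ord i.
  have -> : (2 + (i + (n - 1)) = n + i.+1)%N by lia.
  rewrite modnDl; case: (eqVneq i.+1 n) => [->|ne]; first by rewrite modnn fE //; lia.
  by rewrite modn_small ?fE; do ?[case: ifP => ?]; lia.
- by move=> k hk; rewrite keptE fE //; do ?[case: ifP => ?]; lia.
- by move=> k k' hk; rewrite !fE; try lia; do ?[case: ifP => ?]; lia.
move=> z; rewrite keptE => hz; have hz' := ltn_ord z; case: (ltnP z 4) => z4.
  by exists z; [lia | apply: ord_inj; rewrite fE; do ?[case: ifP => ?]; lia].
case: (ltnP z (h + 4)) => zh.
  by exists (z - 2)%N; [lia | apply: ord_inj; rewrite fE; do ?[case: ifP => ?]; lia].
by exists (z - 4)%N; [lia | apply: ord_inj; rewrite fE; do ?[case: ifP => ?]; lia].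
Qed.

Lemma A_plusP (i j : 'I_n) : (i < j)%N ->
  ([set i; j] \in A_plus n) = plus_rel n h i j.
Proof.
have hh := half_bounds; move=> ij; rewrite -plus_relE //; last by have := ltn_ord j; lia.
rewrite /A_plus inE imset_set2 -/plus_result; rewrite -muln2 in hh.
have e0 : (4%:R : 'I_n.+4) = 4 :> nat by rewrite val_natr; lia.
have e1 : (5%:R : 'I_n.+4) = 5 :> nat by rewrite val_natr; lia.
have e2' : (6%:R : 'I_n.+4) = 6 :> nat by rewrite val_natr; lia.
have e2 : opp_vertex n 4 = (h + 4)%N :> nat by rewrite val_opp_vertex; lia.
have e3 : opp_vertex n 5 = (h + 5)%N :> nat by rewrite val_opp_vertex; lia.
have lt_c : (plus_merge n h < n.+4)%N by rewrite /plus_merge; case: ifP.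
have hj := ltn_ord j.
have := plus_labelled i; have := plus_labelled j.
move: (labelled _ _ _ i) (labelled _ _ _ j) => x y ey ex.
rewrite (@mem_merged n 4%:R 5%:R (opp_vertex n 4) (opp_vertex n 5) 6%:R (Ordinal lt_c)).
all: rewrite -?(inj_eq (@ord_inj _)) ?ex ?ey ?e0 ?e1 ?e2' ?e2 ?e3 //; try lia.
- by rewrite /= /plus_merge; do ?[case: ifP => ?]; lia.
all: by rewrite /plus_label; do ?[case: ifP => ?]; lia.
Qed.

Lemma A_plus_card (e : {set 'I_n}) : e \in A_plus n -> #|e| = 2.
Proof.
rewrite /A_plus inE -/plus_result => /merged_card.
rewrite card_imset; first by apply; lia.
move=> i j /(congr1 (@nat_of_ord _)); rewrite !plus_labelled /plus_label => eq_ij; apply: ord_inj.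
have hh := half_bounds; rewrite -muln2 in hh.
by have := ltn_ord i; have := ltn_ord j; move: eq_ij; do ?[case: ifP => ?]; lia.
Qed.

End Labels.

(** * Contractions of A_n *)

(* The order of two vertices is reversed or not according to [s x (+) s y (+) o],
   and the contributions of [s] cancel out in [separates]. *)
Lemma cyclic_map_twist n m (f : 'I_n -> 'I_m) (s : 'I_n -> bool) (o : bool) :
  (forall x y, f x != f y -> (f x < f y) = (x < y) (+) s x (+) s y (+) o) ->
  cyclic_map f.
Proof.
move=> tw a b c d; rewrite /collapsed /separates !(inj_eq (@ord_inj _)) => /and5P[_ _ _ _ h].
have [//|ab] := eqVneq (f a) (f b); rewrite ?orbT //.
have [|bc] := eqVneq (f b) (f c); rewrite ?orbT //.
have [|cd] := eqVneq (f c) (f d); rewrite ?orbT //.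
have [|da] := eqVneq (f d) (f a); rewrite ?orbT //.
have cb : f c != f b by rewrite eq_sym.
have ad : f a != f d by rewrite eq_sym.
rewrite ?(negPf ad) ?(negPf cb) !tw //= orbF.
by move: h {tw}; do 4 case: (_ < _); do 4 case: (s _); case: o.
Qed.

Lemma minus_rel_nc n h i j k l : 6 < n -> n + 3 <= h.*2 <= n + 4 ->
  i < k < j -> j < l < n -> minus_rel n h i j -> minus_rel n h k l -> false.
Proof.
rewrite -muln2 /minus_rel => n7 hh o1 o2.
by case/or4P => [H|H|H|/or4P[H|H|H|H]]; case/or4P => [H'|H'|H'|/or4P[H'|H'|H'|H']]; lia.
Qed.

Lemma plus_rel_nc n h i j k l : 6 < n -> n + 3 <= h.*2 <= n + 4 ->
  i < k < j -> j < l < n -> plus_rel n h i j -> plus_rel n h k l -> false.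
Proof.
rewrite -muln2 /plus_rel => n7 hh o1 o2.
by case/or4P => [H|H|H|/orP[H|H]]; case/or4P => [H'|H'|H'|/orP[H'|H']]; lia.
Qed.

Section SortedRelation.

Variables (m : nat) (W : {set {set 'I_m}}) (R : rel nat).
Hypothesis W_card : forall e, e \in W -> #|e| = 2.
Hypothesis W_rel : forall i j : 'I_m, i < j -> ([set i; j] \in W) = R i j.

Definition sorted_rel i j := if i < j then R i j else R j i.

Lemma mem_sorted (i j : 'I_m) : i != j -> ([set i; j] \in W) = sorted_rel i j.
Proof.
rewrite /sorted_rel -(inj_eq (@ord_inj m)); case: ltngtP => // lt _; first exact: W_rel.
by rewrite setUC; apply: W_rel.
Qed.

Lemma sorted_nc :
  (forall i j k l, i < k < j -> j < l < m -> R i j -> R k l -> false) ->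
  forall a c b d : 'I_m, [set a; c] \in W -> [set b; d] \in W -> ~~ separates a c b d.
Proof.
move=> nc a c b d.
have aux (i j k l : 'I_m) : i < j -> k < l -> i < k -> [set i; j] \in W ->
    [set k; l] \in W -> ~~ separates i j k l.
  move=> ij kl ik; rewrite !W_rel // => Rij Rkl; apply/negP => s.
  have o1 : i < k < j by move: s; rewrite /separates; lia.
  have o2 : j < l < m by move: s; rewrite /separates ltn_ord; lia.
  by have := nc i j k l o1 o2 Rij Rkl.
have ne (x y : 'I_m) : [set x; y] \in W -> nat_of_ord x != y.
  by move/W_card; rewrite cards2 -(inj_eq (@ord_inj m)); case: (_ != _).
have aux2 (i j k l : 'I_m) : i < j -> k < l -> [set i; j] \in W ->
    [set k; l] \in W -> ~~ separates i j k l.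
  move=> ij kl hij hkl; case: (ltngtP i k) => ik; first exact: aux.
    by rewrite separatesC; apply: aux.
  by rewrite /separates ik eqxx.
have aux3 (i j k l : 'I_m) : i < j -> [set i; j] \in W ->
    [set k; l] \in W -> ~~ separates i j k l.
  move=> ij hij hkl; have := ne _ _ hkl; case: ltngtP => // kl _; first exact: aux2.
  by rewrite separates_swapr; apply: aux2 => //; rewrite setUC.
move=> hac hbd; have := ne _ _ hac; case: ltngtP => // ac _; first exact: aux3.
by rewrite separates_swapl; apply: aux3 => //; rewrite setUC.
Qed.

(** The contraction is maximal and W is non-crossing, so it suffices to send the edges of U into W.
    This reduces the identification of each contracted pair to arithmetic on labels. *)
Lemma contraction_sorted n (U : {set {set 'I_n}}) (f : 'I_n -> 'I_m) (Q : rel nat) :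
  (forall i j k l, i < k < j -> j < l < m -> R i j -> R k l -> false) ->
  is_triangulation U -> cyclic_map f -> (forall i, exists x, f x = i) ->
  (forall i j : 'I_n, i < j -> ([set i; j] \in U) = Q i j) ->
  (forall i j : 'I_n, i < j -> Q i j -> f i != f j -> sorted_rel (f i) (f j)) ->
  contraction f U = W.
Proof.
move=> nc triU f_cyc f_surj U_rel QR; apply: triangulation_maximal.
- exact: contraction_triangulation.
- exact: W_card.
- exact: sorted_nc.
apply/subsetP => e /contractionP[x [y [xy ne ->]]].
have nxy : nat_of_ord x != y by apply: contraNneq ne => /ord_inj ->.
wlog lt : x y nxy xy ne / x < y.
  move=> w; move: (nxy); case: ltngtP => // lt _; first exact: w.
  by rewrite setUC; apply: w; rewrite // 1?eq_sym // setUC.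
by rewrite mem_sorted //; apply: QR; rewrite // -U_rel.
Qed.

End SortedRelation.

(* Contraction of S1, S2, S5, S6, composed with x |-> 4 - x, x + 1, 3 - x, x + 2
   respectively, modulo the number of remaining vertices. *)
Definition fold1 (n v : nat) : nat :=
  if v <= 1 then 4 - v else if v <= 5 then 5 - v else n + 4 - v.

Definition fold2 (n v : nat) : nat :=
  if v == 0 then 1 else if v <= 2 then 2 else if v <= 4 then 3
  else if v.+1 == n then 0 else v.-1.

Definition fold5 (n v : nat) : nat :=
  if (v <= 3) || (v.+1 == n) then 3 else if v <= 5 then 2
  else if v <= 7 then 7 - v else n + 2 - v.

Definition fold6 (n v : nat) : nat :=
  if (v <= 3) || (v.+1 == n) then 2 else if v <= 6 then 3
  else if v + 4 <= n then v - 3 else v + 3 - n.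

Ltac split_ifs := do ?[case: ifP => ?].

Ltac decide_edge fold :=
  rewrite /sorted_rel /minus_rel /plus_rel /fold; split_ifs; try (by exfalso; lia);
  move=> ne; try (by exfalso; lia); decide_atoms.

Ltac minus_edges fold :=
  rewrite -!muln2 => hn hh hh' ij jn;
  case/or4P => [H|H|H|/or4P[H|H|H|H]]; decide_edge fold.

Ltac plus_edges fold :=
  rewrite -!muln2 => hn hh hh' ij jn;
  case/or4P => [H|H|H|/orP[H|H]]; decide_edge fold.

Lemma fold1_minus n h h' i j : 12 < n -> n + 3 <= h.*2 <= n + 4 ->
  n - 1 + 3 <= h'.*2 <= n - 1 + 4 -> i < j -> j < n ->
  minus_rel n h i j -> fold1 n i != fold1 n j ->
  sorted_rel (plus_rel (n - 1) h') (fold1 n i) (fold1 n j).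
Proof. minus_edges fold1. Qed.

Lemma fold1_plus n h h' i j : 12 < n -> n + 3 <= h.*2 <= n + 4 ->
  n - 1 + 3 <= h'.*2 <= n - 1 + 4 -> i < j -> j < n ->
  plus_rel n h i j -> fold1 n i != fold1 n j ->
  sorted_rel (minus_rel (n - 1) h') (fold1 n i) (fold1 n j).
Proof. plus_edges fold1. Qed.

Lemma fold2_minus n h h' i j : 12 < n -> n + 3 <= h.*2 <= n + 4 ->
  n - 2 + 3 <= h'.*2 <= n - 2 + 4 -> i < j -> j < n ->
  minus_rel n h i j -> fold2 n i != fold2 n j ->
  sorted_rel (minus_rel (n - 2) h') (fold2 n i) (fold2 n j).
Proof. minus_edges fold2. Qed.

Lemma fold2_plus n h h' i j : 12 < n -> n + 3 <= h.*2 <= n + 4 ->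
  n - 2 + 3 <= h'.*2 <= n - 2 + 4 -> i < j -> j < n ->
  plus_rel n h i j -> fold2 n i != fold2 n j ->
  sorted_rel (plus_rel (n - 2) h') (fold2 n i) (fold2 n j).
Proof. plus_edges fold2. Qed.

Lemma fold5_minus n h h' i j : 12 < n -> n + 3 <= h.*2 <= n + 4 ->
  n - 5 + 3 <= h'.*2 <= n - 5 + 4 -> i < j -> j < n ->
  minus_rel n h i j -> fold5 n i != fold5 n j ->
  sorted_rel (plus_rel (n - 5) h') (fold5 n i) (fold5 n j).
Proof. minus_edges fold5. Qed.

Lemma fold5_plus n h h' i j : 12 < n -> n + 3 <= h.*2 <= n + 4 ->
  n - 5 + 3 <= h'.*2 <= n - 5 + 4 -> i < j -> j < n ->
  plus_rel n h i j -> fold5 n i != fold5 n j ->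
  sorted_rel (minus_rel (n - 5) h') (fold5 n i) (fold5 n j).
Proof. plus_edges fold5. Qed.

Lemma fold6_minus n h h' i j : 12 < n -> n + 3 <= h.*2 <= n + 4 ->
  n - 6 + 3 <= h'.*2 <= n - 6 + 4 -> i < j -> j < n ->
  minus_rel n h i j -> fold6 n i != fold6 n j ->
  sorted_rel (minus_rel (n - 6) h') (fold6 n i) (fold6 n j).
Proof. minus_edges fold6. Qed.

Lemma fold6_plus n h h' i j : 12 < n -> n + 3 <= h.*2 <= n + 4 ->
  n - 6 + 3 <= h'.*2 <= n - 6 + 4 -> i < j -> j < n ->
  plus_rel n h i j -> fold6 n i != fold6 n j ->
  sorted_rel (plus_rel (n - 6) h') (fold6 n i) (fold6 n j).
Proof. plus_edges fold6. Qed.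

(** * The search in the 12-gon *)

(** The edges, for i < j, of the images of A_n^- and, below, A_n^+ in the 12-gon. *)
Definition end_minus (i j : nat) : bool :=
  [|| j == i.+1, (i == 0) && (j == 11), (i == 0) && (j <= 4), (i == 4) && (j == 11),
      (i == 5) && (10 <= j) | (i == 6) && (8 <= j <= 10)].

Definition end_plus (i j : nat) : bool :=
  [|| j == i.+1, (i == 0) && (9 <= j), (i == 1) && (8 <= j <= 9),
      (i == 2) && (7 <= j <= 8) | (j == 7) && (3 <= i)].

Definition adjacency := seq (seq bool).

Definition entry (M : adjacency) i j : bool := nth false (nth [::] M i) j.

Definition set_entry (M : adjacency) i j v : adjacency :=
  set_nth [::] M i (set_nth false (nth [::] M i) j v).

Definition flip_matrix M a b c d : adjacency :=
  set_entry (set_entry (set_entry (set_entry M a c false) c a false) b d true) d b true.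

Definition end_matrix (R : rel nat) : adjacency :=
  [seq [seq (i != j) && sorted_rel R i j | j <- iota 0 12] | i <- iota 0 12].

(* The vertex v of the n-gon, -4 <= v <= 7, has the label v + 4 in the 12-gon.  The lists
   map a label to the representative of its class under the contractions of S1, S2, S5, S6. *)
Definition glue1 := [:: 0; 1; 2; 3; 4; 6; 6; 7; 8; 9; 10; 11].
Definition glue2 := [:: 0; 1; 2; 3; 4; 6; 6; 8; 8; 9; 10; 11].
Definition glue5 := [:: 0; 1; 2; 7; 7; 7; 7; 7; 9; 9; 10; 11].
Definition glue6 := [:: 0; 1; 2; 7; 7; 7; 7; 7; 10; 10; 10; 11].

Definition glued (f : seq nat) a b c d : bool :=
  let g := nth 0 f in
  [|| eqn (g a) (g b), eqn (g b) (g c), eqn (g c) (g d) | eqn (g d) (g a)].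

Definition counts := (nat * nat * nat * nat)%type.

Definition le_counts (v w : counts) : bool :=
  let: (v1, v2, v5, v6) := v in let: (w1, w2, w5, w6) := w in
  [&& v1 <= w1, v2 <= w2, v5 <= w5 & v6 <= w6].

Definition add_counts (v w : counts) : counts :=
  let: (v1, v2, v5, v6) := v in let: (w1, w2, w5, w6) := w in
  (v1 + w1, v2 + w2, v5 + w5, v6 + w6).

Definition glue_counts a b c d : counts :=
  (nat_of_bool (glued glue1 a b c d), nat_of_bool (glued glue2 a b c d),
   nat_of_bool (glued glue5 a b c d), nat_of_bool (glued glue6 a b c d)).

(** One less than the gains 2, 4, 10, 12: a path exceeding none of these counts would yield none of
    the four bounds. *)
Definition max_counts : counts := (1, 3, 9, 11).

Definition state := (adjacency * counts)%type.

(* The edge {5, 7} of the last triangulation can only be introduced by a flip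
   that is counted by [glue1]. *)
Definition alive (s : state) : bool :=
  le_counts s.2 max_counts && (entry s.1 5 7 || (s.2.1.1.1 == 0)).

Fixpoint common_from i (r r' : seq bool) : seq nat :=
  match r, r' with
  | x :: r1, y :: r1' =>
      if x && y then i :: common_from i.+1 r1 r1' else common_from i.+1 r1 r1'
  | _, _ => [::]
  end.

(** The corners b and d are common neighbours of a and c on the two sides of {a, c}. The test a < b
    < c fixes one of the equivalent orders of the corners; [quad_flip_sorted] brings any visible
    flip to this form. *)
Definition flips_of (s : state) a c : seq state :=
  if entry s.1 a c then
    let L := common_from 0 (nth [::] s.1 a) (nth [::] s.1 c) in
    [seq (flip_matrix s.1 a b c d, add_counts (glue_counts a b c d) s.2)
       | b <- [seq b <- L | a < b < c], d <- [seq d <- L | (d < a) || (c < d)]]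
  else [::].

Definition successors (s : state) : seq state :=
  filter alive (flatten [seq flips_of s a c | a <- iota 0 12, c <- iota 0 12]).

(** A finite map whose keys are the 144 bits of a flattened adjacency matrix. All keys having the
    same length, states are stored only at that depth, and a shorter branch ends in an empty
    leaf. *)
Inductive trie := Leaf of seq state | Node of trie & trie.

Fixpoint lookup (k : seq bool) (t : trie) : seq state :=
  match t with
  | Leaf l => l
  | Node t0 t1 => if k is b :: k' then lookup k' (if b then t1 else t0) else [::]
  end.

Fixpoint insert (s : state) (k : seq bool) (t : trie) : trie :=
  match k with
  | [::] => if t is Leaf l then Leaf (s :: l) else t
  | b :: k' =>
    let: (t0, t1) := if t is Node t0 t1 then (t0, t1) else (Leaf [::], Leaf [::]) in
    if b then Node t0 (insert s k' t1) else Node (insert s k' t0) t1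
  end.

Fixpoint elements (t : trie) : seq state :=
  match t with Leaf l => l | Node t0 t1 => elements t0 ++ elements t1 end.

(** Domination: whatever stays within the bounds after s does so after the stored state, whose
    counters are no larger. *)
Definition covered (t : trie) (s : state) : bool :=
  has (fun s' => le_counts s'.2 s.2 && (s'.1 == s.1)) (lookup (flatten s.1) t).

(** Breadth-first, with [later] collecting the next layer. The fuel only makes the recursion
    structural: should it run out too early, the set found would fail the closure check. *)
Fixpoint search fuel (t : trie) (todo later : seq state) : trie :=
  if fuel is k.+1 then
    match todo with
    | s :: todo' =>
        let: (t', later') :=
          foldl (fun tl s' => if covered tl.1 s' then tl
                            else (insert s' (flatten s'.1) tl.1, s' :: tl.2))
            (t, later) (successors s) in
        search k t' todo' later'
    | [::] => if later is [::] then t else search k t later [::]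
    end
  else t.

Definition initial : state := (end_matrix end_minus, (0, 0, 0, 0)).

(** The 12 - 3 = 9 interior edges of [end_plus]. *)
Definition final_edges :=
  [:: (0, 9); (0, 10); (1, 8); (1, 9); (2, 7); (2, 8); (3, 7); (4, 7); (5, 7)].

Definition closed_under_flips (t : trie) : bool :=
  [&& covered t initial,
      all (fun s => ~~ all (fun e => entry s.1 e.1 e.2) final_edges) (elements t)
    & all (fun s => all (covered t) (successors s)) (elements t)].

(* Nothing has to be proved about the search itself, as its result is checked. *)
Lemma search_closed : closed_under_flips
  (search (100 * 100) (insert initial (flatten initial.1) (Leaf [::])) [:: initial] [::]).
(* The evaluation is left to the kernel, which performs it once, at [Qed]. *)
Proof. by vm_cast_no_check (erefl true). Qed.

Lemma lookup_elements k t s : s \in lookup k t -> s \in elements t.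
Proof.
elim: t k => [l [] //|t0 IH0 t1 IH1 k]; rewrite [elements _]/= mem_cat.
case: k => [//|[] k] /= h; first by rewrite (IH1 k) ?orbT.
by rewrite (IH0 k).
Qed.

Lemma closed_under_flipsP t : closed_under_flips t -> exists L : seq state,
  [/\ exists2 s, s \in L & s.1 = initial.1 /\ le_counts s.2 initial.2,
      forall s, s \in L -> ~~ all (fun e => entry s.1 e.1 e.2) final_edges
    & forall s s', s \in L -> s' \in successors s ->
        exists2 s'', s'' \in L & s''.1 = s'.1 /\ le_counts s''.2 s'.2].
Proof.
have cov s : covered t s -> exists2 s', s' \in elements t & s'.1 = s.1 /\ le_counts s'.2 s.2.
  by case/hasP => s' /lookup_elements hs' /andP[le /eqP e]; exists s'.
case/and3P => h1 /allP h2 /allP h3; exists (elements t); split; [exact: cov | exact: h2 | ].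
by move=> s s' /h3/allP h /h; apply: cov.
Qed.

Definition certificate := closed_under_flipsP search_closed.

(* The vertices -4, ..., 7 become 0, ..., 11, and all others are merged with -4. *)
Definition view (n v : nat) : nat := if v <= 7 then v + 4 else v + 4 - n.

Lemma view_minus n h i j : 12 < n -> n + 3 <= h.*2 <= n + 4 -> i < j -> j < n ->
  minus_rel n h i j -> view n i != view n j ->
  sorted_rel end_minus (view n i) (view n j).
Proof.
rewrite -muln2 => hn hh ij jn; case/or4P => [H|H|H|/or4P[H|H|H|H]];
  rewrite /end_minus; decide_edge view.
Qed.

Lemma view_plus n h i j : 12 < n -> n + 3 <= h.*2 <= n + 4 -> i < j -> j < n ->
  plus_rel n h i j -> view n i != view n j ->
  sorted_rel end_plus (view n i) (view n j).
Proof.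
rewrite -muln2 => hn hh ij jn; case/or4P => [H|H|H|/orP[H|H]];
  rewrite /end_plus; decide_edge view.
Qed.

Lemma end_minus_nc i j k l : i < k < j -> j < l < 12 ->
  end_minus i j -> end_minus k l -> false.
Proof.
move=> o1 o2; case/or4P => [H|H|H|/or3P[H|H|H]];
  case/or4P => [H'|H'|H'|/or3P[H'|H'|H']]; lia.
Qed.

Lemma end_plus_nc i j k l : i < k < j -> j < l < 12 ->
  end_plus i j -> end_plus k l -> false.
Proof.
move=> o1 o2; case/or4P => [H|H|H|/orP[H|H]];
  case/or4P => [H'|H'|H'|/orP[H'|H']]; lia.
Qed.

Definition rel_edges m (R : rel nat) : {set {set 'I_m}} :=
  [set [set p.1; p.2] | p in [set p : 'I_m * 'I_m | (p.1 < p.2) && R p.1 p.2]].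

Lemma rel_edges_card m R (e : {set 'I_m}) : e \in rel_edges m R -> #|e| = 2.
Proof.
case/imsetP => -[i j]; rewrite inE /= => /andP[ij _] ->.
by rewrite cards2 -(inj_eq (@ord_inj m)) neq_ltn ij.
Qed.

Lemma mem_rel_edges m R (i j : 'I_m) : i < j -> ([set i; j] \in rel_edges m R) = R i j.
Proof.
move=> ij; apply/imsetP/idP => [[[k l]]|Rij].
  rewrite inE /= => /andP[kl Rkl] /eqP/set2_eqP[[-> ->] //|[e1 e2]].
  by move: ij; rewrite e1 e2 ltnNge ltnW.
by exists (i, j); rewrite // inE ij.
Qed.

Definition represents (M : adjacency) (U : {set {set 'I_12}}) : Prop :=
  forall i j : 'I_12, entry M i j = ([set i; j] \in U).

Lemma represents_end R : represents (end_matrix R) (rel_edges 12 R).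
Proof.
move=> i j; rewrite /entry /end_matrix (nth_map 0) ?size_iota //.
rewrite (nth_map 0) ?size_iota // !nth_iota // !add0n.
have [e|ne] := eqVneq i j.
  rewrite e eqxx /=; apply/esym/negP => /rel_edges_card.
  by rewrite setUid cards1.
rewrite (inj_eq (@ord_inj _)) ne /=.
by rewrite (mem_sorted (@mem_rel_edges 12 R)).
Qed.

Lemma entry_set_entry M i j v x y :
  entry (set_entry M i j v) x y = if (x == i) && (y == j) then v else entry M x y.
Proof.
rewrite /entry /set_entry nth_set_nth /=; have [->|//] := eqVneq x i.
by rewrite nth_set_nth /=; case: eqVneq.
Qed.

Lemma represents_flip M U V (a b c d : 'I_12) :
  represents M U -> quad_flip U V a b c d -> represents (flip_matrix M a b c d) V.
Proof.
move=> repM [s _ _ ->] x y; rewrite /flip_matrix !entry_set_entry repM !inE.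
rewrite !(inj_eq (@ord_inj _)).
have set2E (u v : 'I_12) :
    ([set x; y] == [set u; v]) = (x == v) && (y == u) || (x == u) && (y == v).
  apply/set2_eqP/idP => [[[-> ->]|[-> ->]]|/orP[/andP[/eqP-> /eqP->]|/andP[/eqP-> /eqP->]]].
  - by rewrite !eqxx orbT.
  - by rewrite !eqxx.
  - by right.
  by left.
rewrite !set2E; case: ((x == d) && _) => //; case: ((x == b) && _) => //.
by case: ((x == c) && _) => //; case: ((x == a) && _).
Qed.

Lemma mem_common_from i r r' x : nth false r x -> nth false r' x ->
  i + x \in common_from i r r'.
Proof.
elim: r r' i x => [|y r IH] [|y' r'] i [|x] //=; first by move=> -> ->; rewrite addn0 mem_head.
move=> h h'; rewrite addnS -addSn; case: ifP => _; last exact: IH.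
by rewrite inE IH ?orbT.
Qed.

Lemma mem_successors M v U V (a b c d : 'I_12) : represents M U ->
  quad_flip U V a b c d -> a < b < c -> (d < a) || (c < d) ->
  alive (flip_matrix M a b c d, add_counts (glue_counts a b c d) v) ->
  (flip_matrix M a b c d, add_counts (glue_counts a b c d) v) \in successors (M, v).
Proof.
move=> repM [s ac [ab bc cd da] _] abc cda al; rewrite mem_filter al andTb.
apply/flattenP; exists (flips_of (M, v) a c).
  by apply: allpairs_f; rewrite mem_iota /= add0n ltn_ord.
rewrite /flips_of /= repM ac.
apply: (allpairs_f (fun b d => (flip_matrix M a b c d, add_counts (glue_counts a b c d) v))).
  rewrite mem_filter abc; apply: (@mem_common_from 0); first by rewrite -/(entry _ _ _) repM.
  by rewrite -/(entry _ _ _) repM setUC.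
rewrite mem_filter cda; apply: (@mem_common_from 0).
  by rewrite -/(entry _ _ _) repM setUC.
by rewrite -/(entry _ _ _) repM.
Qed.

(** * Counting the undone flips *)

Section Walk.

Variables (n m1 m2 m5 m6 : nat) (w : 'I_n -> 'I_12).
Variables (f1 : 'I_n -> 'I_m1) (f2 : 'I_n -> 'I_m2).
Variables (f5 : 'I_n -> 'I_m5) (f6 : 'I_n -> 'I_m6).
Implicit Types (U V : {set {set 'I_n}}) (s : seq {set {set 'I_n}}).

(** The premise [w x != w y] matters, since [w] merges many vertices with -4 that [f] keeps apart.
    It is available for consecutive corners of a quadrilateral that [w] does not collapse. *)
Definition glues m (f : 'I_n -> 'I_m) (g : seq nat) : Prop := forall x y,
  w x != w y -> nth 0 g (w x) = nth 0 g (w y) -> f x = f y.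

Hypothesis w_cyclic : cyclic_map w.
Hypotheses (f1_glues : glues f1 glue1) (f2_glues : glues f2 glue2).
Hypotheses (f5_glues : glues f5 glue5) (f6_glues : glues f6 glue6).

Definition total_counts U s : counts :=
  (collapses f1 U s, collapses f2 U s, collapses f5 U s, collapses f6 U s).

Definition step_counts U V : counts :=
  (nat_of_bool (contraction f1 U == contraction f1 V),
   nat_of_bool (contraction f2 U == contraction f2 V),
   nat_of_bool (contraction f5 U == contraction f5 V),
   nat_of_bool (contraction f6 U == contraction f6 V)).

(** Only an inequality is claimed: the 12-gon gives a lower bound for the flips undone by [f], which
    is all that the count requires. *)
Lemma glued_contraction m (f : 'I_n -> 'I_m) g U V a b c d : glues f g ->
  is_triangulation U -> quad_flip U V a b c d -> ~~ collapsed w a b c d ->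
  glued g (w a) (w b) (w c) (w d) <= (contraction f U == contraction f V).
Proof.
move=> fg triU q; rewrite !negb_or => /and4P[ab bc cd da].
case gl : (glued _ _ _ _ _) => //.
have col : collapsed f a b c d; last by rewrite (quad_flip_collapsed triU q col) eqxx.
rewrite /collapsed; case/or4P: gl => /eqnP e.
- by rewrite (fg _ _ ab e) eqxx.
- by rewrite (fg _ _ bc e) eqxx orbT.
- by rewrite (fg _ _ cd e) eqxx !orbT.
by rewrite (fg _ _ da e) eqxx !orbT.
Qed.

Lemma glue_step U V a b c d : is_triangulation U -> quad_flip U V a b c d ->
  ~~ collapsed w a b c d ->
  le_counts (glue_counts (w a) (w b) (w c) (w d)) (step_counts U V).
Proof. by move=> triU q col; apply/and4P; split; apply: (glued_contraction _ triU q). Qed.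

Lemma le_counts_add u u' v v' t : le_counts u u' -> le_counts v v' ->
  le_counts (add_counts v' (add_counts u' t)) max_counts ->
  le_counts (add_counts (add_counts u v) t) max_counts.
Proof.
case: u u' v v' t => [[[? ?] ?] ?] [[[? ?] ?] ?] [[[? ?] ?] ?] [[[? ?] ?] ?] [[[? ?] ?] ?] /=.
lia.
Qed.

Lemma le_counts_addr u v t : le_counts v u ->
  le_counts (add_counts u t) max_counts -> le_counts (add_counts v t) max_counts.
Proof.
by case: u v t => [[[? ?] ?] ?] [[[? ?] ?] ?] [[[? ?] ?] ?] /=; lia.
Qed.

Let chord := [set (@inord 11 5); @inord 11 7].

(** Consider the flip after which the chord {5, 7} is present in the 12-gon. Its quadrilateral has a
    corner strictly between 5 and 7, that is 6, and [glue1] merges 5 with 6, so the flip is undone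
    by [f1]. *)
Lemma chord_counted U s : path (flip (std_polygon n)) U s ->
  chord \notin contraction w U -> chord \in contraction w (last U s) ->
  0 < collapses f1 U s.
Proof.
elim: s U => [|V s IHs] U /=; first by move=> _ /negPf ->.
case/andP => /flip_stdP[/triangulation_std[_ triU] [a [b [c [d q]]]]] ps nU hl.
have [hV|hV] := boolP (chord \in contraction w V); last first.
  by apply: leq_trans (leq_addl _ _); apply: IHs.
have [col|col] := boolP (collapsed w a b c d).
  by rewrite (quad_flip_collapsed triU q col) (negPf nU) in hV.
have gl := glued_contraction f1_glues triU q col.
rewrite (leq_trans _ (leq_trans gl (leq_addr _ _))) // lt0b.
have [s' _ _ eV] := quad_flip_contraction w_cyclic triU q col.
move: hV; rewrite eV !inE (negPf nU) andbF orbF => /set2_eqP e.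
have e5 : @inord 11 5 = 5 :> nat by rewrite inordK.
have e7 : @inord 11 7 = 7 :> nat by rewrite inordK.
have : (w a == 6 :> nat) || (w c == 6 :> nat).
  by move: s'; case: e => [[<- <-]|[<- <-]]; rewrite /separates e5 e7; lia.
by rewrite /glued; case: e => [[<- <-]|[<- <-]]; rewrite ?e5 ?e7;
  case/orP => /eqP ->; rewrite /= ?orbT.
Qed.

Lemma quad_flip_rot U V a b c d : quad_flip U V a b c d -> quad_flip U V c d a b.
Proof.
move=> [s ac [ab bc cd da] ->]; split.
- by rewrite separates_swapl separates_swapr.
- by rewrite setUC.
- by [].
by rewrite [ [set c; a] ]setUC [ [set d; b] ]setUC.
Qed.

Lemma quad_flip_rev U V a b c d : quad_flip U V a b c d -> quad_flip U V a d c b.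
Proof.
move=> [s ac [ab bc cd da] ->]; split; rewrite // 1?separates_swapr //.
  by split; rewrite setUC.
by rewrite [ [set d; b] ]setUC.
Qed.

Lemma collapsed_rot a b c d : collapsed w c d a b = collapsed w a b c d.
Proof. by rewrite /collapsed; do 4 case: (_ == _). Qed.

Lemma collapsed_rev a b c d : collapsed w a d c b = collapsed w a b c d.
Proof.
by rewrite /collapsed ![w _ == w b]eq_sym ![_ == w c]eq_sym ![_ == w a]eq_sym; do 4 case: (_ == _).
Qed.

(** The corners can be rotated and reflected without changing the flip. As their images still
    alternate, some such renaming puts them in the order that [flips_of] enumerates. *)
Lemma quad_flip_sorted U V a b c d : is_triangulation U -> quad_flip U V a b c d ->
  ~~ collapsed w a b c d -> exists a' b' c' d', [/\ quad_flip U V a' b' c' d',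
    ~~ collapsed w a' b' c' d', w a' < w b' < w c' & (w d' < w a') || (w c' < w d')].
Proof.
move=> triU q col.
wlog ac : a b c d q col / w a < w c.
  move=> wl; have [s _ _ _] := quad_flip_contraction w_cyclic triU q col.
  have [_ _ _ _ /andP[+ _]] := separates_neq s; case: ltngtP => // lt _; first exact: (wl a b c d).
  by apply: (wl c d a b) => //; [apply: quad_flip_rot | rewrite collapsed_rot].
wlog abc : b d q col / w a < w b < w c.
  move=> wl; have [abc|nabc] := boolP (w a < w b < w c); first exact: (wl b d).
  apply: (wl d b); [exact: quad_flip_rev | by rewrite collapsed_rev |].
  have [s _ _ _] := quad_flip_contraction w_cyclic triU q col.
  by move: s nabc; rewrite /separates; lia.
exists a, b, c, d; split=> //.
have [s _ _ _] := quad_flip_contraction w_cyclic triU q col.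
by move: s; rewrite /separates; lia.
Qed.

(** The bound on v plus the counts still to come is kept along the path, so the counters never
    exceed [max_counts] and each visible step leads to a state that [alive] retains. Moving to a
    dominating state of L only lowers v. *)
Lemma walk_invariant (L : seq state) U s (M : adjacency) (v : counts) :
  (forall t t' : state, t \in L -> t' \in successors t ->
     exists2 t'', t'' \in L & t''.1 = t'.1 /\ le_counts t''.2 t'.2) ->
  path (flip (std_polygon n)) U s -> chord \in contraction w (last U s) ->
  (M, v) \in L -> represents M (contraction w U) ->
  le_counts (add_counts v (total_counts U s)) max_counts ->
  exists M' v', (M', v') \in L /\ represents M' (contraction w (last U s)).
Proof.
move=> closed; elim: s U M v => [|V s IHs] U M v /=; first by exists M, v.
case/andP => /flip_stdP[/triangulation_std[_ triU] [a [b [c [d q]]]]] ps hl ML repM le_v.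
have le_refl u : le_counts u u by case: u => [[[? ?] ?] ?] /=; rewrite !leqnn.
have eT : total_counts U (V :: s) = add_counts (step_counts U V) (total_counts V s) by [].
rewrite -/(total_counts U (V :: s)) eT in le_v.
(* A flip collapsed by [w] leaves the state unchanged; what it adds to the counts is discarded,
   which only weakens the bound. *)
have [col|ncol] := boolP (collapsed w a b c d).
  apply: (IHs V M v) => //; first by rewrite (quad_flip_collapsed triU q col).
  have le0 : le_counts (0, 0, 0, 0) (step_counts U V) by [].
  by have := le_counts_add le0 (le_refl v) le_v; case: (v) => [[[? ?] ?] ?].
have {a b c d q ncol} [a [b [c [d [q col abc cda]]]]] := quad_flip_sorted triU q ncol.
have qw := quad_flip_contraction w_cyclic triU q col.
have repM' := represents_flip repM qw.
have le_step := glue_step triU q col.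
have le_w := le_counts_add le_step (le_refl v) le_v.
set u := add_counts _ v in le_w.
have al : alive (flip_matrix M (w a) (w b) (w c) (w d), u).
  apply/andP; split; rewrite /=.
    by move: u le_w => [[[? ?] ?] ?] /=; lia.
  have -> : entry (flip_matrix M (w a) (w b) (w c) (w d)) 5 7 = (chord \in contraction w V).
    by rewrite -repM' !inordK.
  (* If the chord is still missing, a later flip is undone by [f1]; at most one is allowed in all,
     so the first counter is still 0. *)
  case: (boolP (chord \in _)) => //= nV; have := chord_counted ps nV hl.
  by move: u le_w => [[[? ?] ?] ?] /=; lia.
have [[M'' v''] hL /= [eM le_v'']] := closed _ _ ML (mem_successors repM qw abc cda al).
apply: (IHs V M'' v'') => //; first by rewrite eM.
exact: le_counts_addr le_v'' le_w.
Qed.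

End Walk.

(** * The contracting maps and their compatibility with the 12-gon *)

Section OrdinalMaps.

Variables (n m : nat) (g : nat -> nat) (s : nat -> bool) (o : bool).
Hypothesis g_lt : forall x, x < n -> g x < m.
Hypothesis g_twist : forall x y, x < n -> y < n -> g x != g y ->
  (g x < g y) = (x < y) (+) s x (+) s y (+) o.
Hypothesis g_surj : forall i, i < m -> exists2 x, x < n & g x = i.

Lemma ordinal_map : exists f : 'I_n -> 'I_m,
  [/\ forall x, f x = g x :> nat, cyclic_map f & forall i, exists x, f x = i].
Proof.
pose f (x : 'I_n) := Ordinal (g_lt (ltn_ord x)); exists f; split=> // [|i].
  apply: (@cyclic_map_twist _ _ _ s o) => x y; rewrite -(inj_eq (@ord_inj _)).
  exact: g_twist.
have [x xn e] := g_surj (ltn_ord i).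
by exists (Ordinal xn); apply: ord_inj.
Qed.

End OrdinalMaps.

Section Folds.

Variable n : nat.
Hypothesis n_gt12 : 12 < n.

Lemma view_map : exists w : 'I_n -> 'I_12,
  [/\ forall x, w x = view n x :> nat, cyclic_map w & forall i, exists x, w x = i].
Proof.
(* The vertices up to 7 are those before the cut: labels restart at 0 just after 7, and orientation
   is kept. *)
apply: (@ordinal_map n 12 (view n) (fun x => x <= 7) false) => [x|x y hx hy|i hi].
- by rewrite /view; case: ifP; lia.
- by rewrite /view; do ?[case: ifP => ?]; lia.
have [lt|ge] := ltnP i 4; first by exists (n - 4 + i); rewrite /view; do ?[case: ifP => ?]; lia.
by exists (i - 4); rewrite /view; do ?[case: ifP => ?]; lia.
Qed.

Lemma fold1_map : exists f : 'I_n -> 'I_(n - 1),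
  [/\ forall x, f x = fold1 n x :> nat, cyclic_map f & forall i, exists x, f x = i].
Proof.
(* Here [true] records that the map reverses the orientation, and the cut lies between 5, sent to 0,
   and 6, sent to n - 2. *)
apply: (@ordinal_map n (n - 1) (fold1 n) (fun x => x <= 5) true) => [x|x y hx hy|i hi].
- by rewrite /fold1; do ?[case: ifP => ?]; lia.
- by rewrite /fold1; do ?[case: ifP => ?]; lia.
have [->|?] := eqVneq i 4; first by exists 0; rewrite /fold1; do ?[case: ifP => ?] => //; lia.
have [lt|ge] := leqP i 3; first by exists (5 - i); rewrite /fold1; do ?[case: ifP => ?]; lia.
by exists (n + 4 - i); rewrite /fold1; do ?[case: ifP => ?]; lia.
Qed.

Lemma fold2_map : exists f : 'I_n -> 'I_(n - 2),
  [/\ forall x, f x = fold2 n x :> nat, cyclic_map f & forall i, exists x, f x = i].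
Proof.
apply: (@ordinal_map n (n - 2) (fold2 n) (fun x => x.+1 == n) false) => [x|x y hx hy|i hi].
- by rewrite /fold2; do ?[case: ifP => ?]; lia.
- by rewrite /fold2; do ?[case: ifP => ?]; lia.
have [->|?] := eqVneq i 0; first by exists n.-1; rewrite /fold2; do ?[case: ifP => ?] => //; lia.
have [->|?] := eqVneq i 1; first by exists 0; rewrite /fold2; do ?[case: ifP => ?] => //; lia.
have [->|?] := eqVneq i 2; first by exists 2; rewrite /fold2; do ?[case: ifP => ?] => //; lia.
by exists i.+1; rewrite /fold2; do ?[case: ifP => ?]; lia.
Qed.

Lemma fold5_map : exists f : 'I_n -> 'I_(n - 5),
  [/\ forall x, f x = fold5 n x :> nat, cyclic_map f & forall i, exists x, f x = i].
Proof.
apply: (@ordinal_map n (n - 5) (fold5 n) (fun x => x <= 7) true) => [x|x y hx hy|i hi].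
- by rewrite /fold5; do ?[case: ifP => ?]; lia.
- by rewrite /fold5; do ?[case: ifP => ?]; lia.
have [->|?] := eqVneq i 3; first by exists 0; rewrite /fold5; do ?[case: ifP => ?] => //; lia.
have [->|?] := eqVneq i 2; first by exists 4; rewrite /fold5; do ?[case: ifP => ?] => //; lia.
have [lt|ge] := leqP i 1; first by exists (7 - i); rewrite /fold5; do ?[case: ifP => ?]; lia.
by exists (n + 2 - i); rewrite /fold5; do ?[case: ifP => ?]; lia.
Qed.

Lemma fold6_map : exists f : 'I_n -> 'I_(n - 6),
  [/\ forall x, f x = fold6 n x :> nat, cyclic_map f & forall i, exists x, f x = i].
Proof.
apply: (@ordinal_map n (n - 6) (fold6 n) (fun x => n < x + 4) false) => [x|x y hx hy|i hi].
- by rewrite /fold6; do ?[case: ifP => ?]; lia.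
- by rewrite /fold6; do ?[case: ifP => ?]; lia.
have [lt|ge] := leqP i 1; first by exists (n - 3 + i); rewrite /fold6; do ?[case: ifP => ?]; lia.
have [->|?] := eqVneq i 2; first by exists 0; rewrite /fold6; do ?[case: ifP => ?] => //; lia.
by exists (i + 3); rewrite /fold6; do ?[case: ifP => ?]; lia.
Qed.

End Folds.

(** Replaces the table g, checked on all pairs of labels, by inequalities C that [lia] can use. *)
Lemma glue_class (g : seq nat) (C : rel nat) :
  all (fun a => all (fun b => (a != b) && (nth 0 g a == nth 0 g b) ==> C a b) (iota 0 12))
    (iota 0 12) ->
  forall a b : 'I_12, a != b -> nth 0 g a = nth 0 g b -> C a b.
Proof.
move=> /allP h a b ne e.
have in12 (i : 'I_12) : nat_of_ord i \in iota 0 12 by rewrite mem_iota ltn_ord.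
have /allP/(_ _ (in12 b))/implyP := h _ (in12 a); apply.
by rewrite e eqxx (inj_eq (@ord_inj _)) ne.
Qed.

Section Gluing.

Variables (n : nat) (w : 'I_n -> 'I_12).
Hypotheses (n_gt12 : 12 < n) (wE : forall x, w x = view n x :> nat).

Lemma fold1_glues (f : 'I_n -> 'I_(n - 1)) :
  (forall x, f x = fold1 n x :> nat) -> glues w f glue1.
Proof.
move=> fE x y ne e; apply: ord_inj; rewrite !fE.
have := @glue_class glue1 (fun a b => (5 <= a <= 6) && (5 <= b <= 6)) isT _ _ ne e.
by rewrite !wE /view /fold1; have := ltn_ord x; have := ltn_ord y; do ?[case: ifP => ?]; lia.
Qed.

Lemma fold2_glues (f : 'I_n -> 'I_(n - 2)) :
  (forall x, f x = fold2 n x :> nat) -> glues w f glue2.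
Proof.
move=> fE x y ne e; apply: ord_inj; rewrite !fE.
have := @glue_class glue2 (fun a b =>
  (5 <= a <= 6) && (5 <= b <= 6) || (7 <= a <= 8) && (7 <= b <= 8)) isT _ _ ne e.
by rewrite !wE /view /fold2; have := ltn_ord x; have := ltn_ord y; do ?[case: ifP => ?]; lia.
Qed.

Lemma fold5_glues (f : 'I_n -> 'I_(n - 5)) :
  (forall x, f x = fold5 n x :> nat) -> glues w f glue5.
Proof.
move=> fE x y ne e; apply: ord_inj; rewrite !fE.
have := @glue_class glue5 (fun a b =>
  (3 <= a <= 7) && (3 <= b <= 7) || (8 <= a <= 9) && (8 <= b <= 9)) isT _ _ ne e.
by rewrite !wE /view /fold5; have := ltn_ord x; have := ltn_ord y; do ?[case: ifP => ?]; lia.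
Qed.

Lemma fold6_glues (f : 'I_n -> 'I_(n - 6)) :
  (forall x, f x = fold6 n x :> nat) -> glues w f glue6.
Proof.
move=> fE x y ne e; apply: ord_inj; rewrite !fE.
have := @glue_class glue6 (fun a b =>
  (3 <= a <= 7) && (3 <= b <= 7) || (8 <= a <= 10) && (8 <= b <= 10)) isT _ _ ne e.
by rewrite !wE /view /fold6; have := ltn_ord x; have := ltn_ord y; do ?[case: ifP => ?]; lia.
Qed.

End Gluing.

(** * Assembling the bound *)

Lemma path_triangulation n U (s : seq {set {set 'I_n}}) :
  triangulation (std_polygon n) U -> path (flip (std_polygon n)) U s ->
  triangulation (std_polygon n) (last U s).
Proof. by elim: s U => //= V s IHs U _ /andP[/flip_triangulation]; apply: IHs. Qed.

(** The edge {2, 4} belongs to A_n^- only. This excludes an empty flip path, the one case where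
    [flip] says nothing about A_n^-. *)
Lemma A_minus_neq_plus n : 12 < n -> A_minus n <> A_plus n.
Proof.
move=> n12 e.
have lt2 : 2 < n by lia.
have lt4 : 4 < n by lia.
have n6 : 6 < n by lia.
have hh := half_bounds n6; rewrite -muln2 in hh.
have := A_plusP n6 (isT : Ordinal lt2 < Ordinal lt4).
by rewrite -e A_minusP // /minus_rel /plus_rel /=; lia.
Qed.

(** [find] returns the length of the list when no element qualifies, whence the value in the
    unreachable case. *)
Lemma flip_dist_geodesic n U V :
  flip_dist (std_polygon n) U V = #|{set {set 'I_n}}| \/
  exists s, [/\ path (flip (std_polygon n)) U s, last U s = V
    & size s = flip_dist (std_polygon n) U V].
Proof.
have [|no] := boolP (has (flip_reach (std_polygon n) U V) (iota 0 #|{set {set 'I_n}}|)).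
  case/hasP => k _ /flip_reachP[s [ps ls _]]; right.
  by have [/flip_reachP[s' [ps' ls' <-]] _] := flip_distP ps ls; exists s'.
by left; rewrite /flip_dist hasNfind // size_iota.
Qed.

Lemma delta_A_le n : delta_A n <= #|{set {set 'I_n}}|.
Proof. by rewrite /delta_A /flip_dist; apply: leq_trans (find_size _ _) _; rewrite size_iota. Qed.

(** The cardinality is 2 ^ (2 ^ n), which is squared when n grows by one. It compares the default
    value of [flip_dist] for n with the largest value of [delta_A (n - 1) + 2]. *)
Lemma card_setsetS n : 0 < n -> #|{set {set 'I_(n - 1)}}| + 2 <= #|{set {set 'I_n}}|.
Proof.
case: n => // n _; rewrite subSS subn0.
have E m : #|{set {set 'I_m}}| = 2 ^ (2 ^ m).
  have P (T : finType) : #|{set T}| = 2 ^ #|T|.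
    by rewrite -(cardsT T) -card_powerset powersetT cardsT.
  by rewrite !P card_ord.
rewrite !E expnS mul2n -addnn expnD.
have : 2 <= 2 ^ (2 ^ n) by rewrite -{1}(expn1 2) leq_exp2l // expn_gt0.
nia.
Qed.

Section ContractionOfA.

Variables (n m : nat) (f : 'I_n -> 'I_m) (g : nat -> nat).
Hypotheses (fE : forall x, f x = g x :> nat) (f_cyclic : cyclic_map f).
Hypothesis f_surj : forall i, exists x, f x = i.

Lemma contraction_of_rel (U : {set {set 'I_n}}) (W : {set {set 'I_m}}) (Q R : rel nat) :
  is_triangulation U ->
  (forall i j : 'I_n, i < j -> ([set i; j] \in U) = Q i j) ->
  (forall e, e \in W -> #|e| = 2) ->
  (forall i j : 'I_m, i < j -> ([set i; j] \in W) = R i j) ->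
  (forall i j k l, i < k < j -> j < l < m -> R i j -> R k l -> false) ->
  (forall i j, i < j -> j < n -> Q i j -> g i != g j -> sorted_rel R (g i) (g j)) ->
  contraction f U = W.
Proof.
move=> triU UQ W2 WR Rnc QR.
apply: (contraction_sorted W2 WR Rnc triU f_cyclic f_surj UQ) => i j ij Qij.
by rewrite -(inj_eq (@ord_inj _)) !fE; apply: QR.
Qed.

Hypotheses (n_gt6 : 6 < n) (m_gt6 : 6 < m).
Hypotheses (triM : is_triangulation (A_minus n)) (triP : is_triangulation (A_plus n)).
Let h := n./2 + 2.
Let h' := m./2 + 2.
Let maps (Q R : rel nat) := forall i j, i < j -> j < n -> Q i j -> g i != g j ->
  sorted_rel R (g i) (g j).

Lemma contraction_to_minus U (Q : rel nat) : is_triangulation U ->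
  (forall i j : 'I_n, i < j -> ([set i; j] \in U) = Q i j) ->
  maps Q (minus_rel m h') -> contraction f U = A_minus m.
Proof.
move=> triU UQ; apply: contraction_of_rel triU UQ _ _ _.
- exact: A_minus_card.
- exact: A_minusP.
by move=> i j k l; apply: minus_rel_nc; rewrite // half_bounds.
Qed.

Lemma contraction_to_plus U (Q : rel nat) : is_triangulation U ->
  (forall i j : 'I_n, i < j -> ([set i; j] \in U) = Q i j) ->
  maps Q (plus_rel m h') -> contraction f U = A_plus m.
Proof.
move=> triU UQ; apply: contraction_of_rel triU UQ _ _ _.
- exact: A_plus_card.
- exact: A_plusP.
by move=> i j k l; apply: plus_rel_nc; rewrite // half_bounds.
Qed.

Variable s : seq {set {set 'I_n}}.
Hypotheses (ps : path (flip (std_polygon n)) (A_minus n) s).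
Hypothesis ls : last (A_minus n) s = A_plus n.

Lemma delta_A_contraction : maps (minus_rel n h) (minus_rel m h') ->
  maps (plus_rel n h) (plus_rel m h') ->
  delta_A m + collapses f (A_minus n) s <= size s.
Proof.
move=> mm pp; have m2 : 2 < m by apply: leq_trans m_gt6.
have := flip_dist_contraction f_cyclic f_surj m2 ps; rewrite ls.
rewrite (contraction_to_minus triM (A_minusP n_gt6) mm).
by rewrite (contraction_to_plus triP (A_plusP n_gt6) pp).
Qed.

(** The case of the reflections, used for S1 and S5. *)
Lemma delta_A_contraction_swap : maps (minus_rel n h) (plus_rel m h') ->
  maps (plus_rel n h) (minus_rel m h') ->
  delta_A m + collapses f (A_minus n) s <= size s.
Proof.
move=> mp pm; have m2 : 2 < m by apply: leq_trans m_gt6.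
have := flip_dist_contraction_rev f_cyclic f_surj m2 ps; rewrite ls.
rewrite (contraction_to_plus triM (A_minusP n_gt6) mp).
by rewrite (contraction_to_minus triP (A_plusP n_gt6) pm).
Qed.

End ContractionOfA.

Theorem theorem11 (n : nat) (hn : 12 < n) :
  minn (minn (delta_A (n - 1) + 2) (delta_A (n - 2) + 4))
       (minn (delta_A (n - 5) + 10) (delta_A (n - 6) + 12)) <= delta_A n.
Proof.
have n6 : 6 < n by lia.
have [unreachable|[s [ps ls ss]]] := flip_dist_geodesic (A_minus n) (A_plus n).
  (* With no path at all the first term of the minimum is already small enough. *)
  rewrite [leqRHS]unreachable !geq_min; do 2 (apply/orP; left).
  by apply: leq_trans (card_setsetS _); [rewrite leq_add2r delta_A_le | lia].
(* The path has a first flip, and its source is a triangulation. *)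
have tri0 : triangulation (std_polygon n) (A_minus n).
  case: s ps ls {ss} => [_ /= /(A_minus_neq_plus hn) //|V s /= /andP[]].
  by case/flip_stdP.
have := path_triangulation tri0 ps; rewrite ls => /triangulation_std[_ triP].
have /triangulation_std[_ triM] := tri0.
have bounds k : 6 < k -> k + 3 <= (k./2 + 2).*2 <= k + 4 by apply: half_bounds.
have [w [wE w_cyc w_surj]] := view_map hn.
have [f1 [f1E f1_cyc f1_surj]] := fold1_map hn.
have [f2 [f2E f2_cyc f2_surj]] := fold2_map hn.
have [f5 [f5E f5_cyc f5_surj]] := fold5_map hn.
have [f6 [f6E f6_cyc f6_surj]] := fold6_map hn.
have wM : contraction w (A_minus n) = rel_edges 12 end_minus.
  apply: (contraction_of_rel wE w_cyc w_surj triM (A_minusP n6)).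
  - exact: rel_edges_card.
  - exact: mem_rel_edges.
  - exact: end_minus_nc.
  by move=> i j; apply: view_minus; rewrite ?bounds.
have wP : contraction w (A_plus n) = rel_edges 12 end_plus.
  apply: (contraction_of_rel wE w_cyc w_surj triP (A_plusP n6)).
  - exact: rel_edges_card.
  - exact: mem_rel_edges.
  - exact: end_plus_nc.
  by move=> i j; apply: view_plus; rewrite ?bounds.
(* If no count exceeds its maximum, the certified list contains a state for the last triangulation,
   with all of [final_edges]: a contradiction. Otherwise one exceeded count gives one of the four
   bounds. *)
have [|exceeded] := boolP (le_counts (total_counts f1 f2 f5 f6 (A_minus n) s) max_counts).
  move=> le_tot; have [L [[[M v] ML [eM le_v]] no_final closed]] := certificate.
  have {}le_tot : le_counts (add_counts initial.2 (total_counts f1 f2 f5 f6 (A_minus n) s))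
    max_counts by [].
  have [||M' [v' [ML' repM']]] := walk_invariant w_cyc (fold1_glues hn wE f1E)
    (fold2_glues hn wE f2E) (fold5_glues hn wE f5E) (fold6_glues hn wE f6E)
    closed ps _ ML _ (le_counts_addr le_v le_tot).
  - by rewrite ls wP mem_rel_edges ?inordK.
  - by rewrite wM (eM : M = _); apply: represents_end.
  have /negP[] := no_final _ ML'; apply/allP => -[i j] ij; rewrite ls wP in repM'.
  have /allP/(_ _ ij)/and3P[lt_ij j12 Rij] :
    all (fun e => [&& e.1 < e.2, e.2 < 12 & end_plus e.1 e.2]) final_edges by [].
  by have := repM' (Ordinal (ltn_trans lt_ij j12)) (Ordinal j12); rewrite mem_rel_edges // => ->.
have [m1 m2 m5 m6] : [/\ 6 < n - 1, 6 < n - 2, 6 < n - 5 & 6 < n - 6] by split; lia.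
have delta1 : delta_A (n - 1) + collapses f1 (A_minus n) s <= size s.
  apply: (delta_A_contraction_swap f1E) => //= i j.
    by apply: fold1_minus; rewrite ?bounds.
  by apply: fold1_plus; rewrite ?bounds.
have delta2 : delta_A (n - 2) + collapses f2 (A_minus n) s <= size s.
  apply: (delta_A_contraction f2E) => //= i j.
    by apply: fold2_minus; rewrite ?bounds.
  by apply: fold2_plus; rewrite ?bounds.
have delta5 : delta_A (n - 5) + collapses f5 (A_minus n) s <= size s.
  apply: (delta_A_contraction_swap f5E) => //= i j.
    by apply: fold5_minus; rewrite ?bounds.
  by apply: fold5_plus; rewrite ?bounds.
have delta6 : delta_A (n - 6) + collapses f6 (A_minus n) s <= size s.
  apply: (delta_A_contraction f6E) => //= i j.
    by apply: fold6_minus; rewrite ?bounds.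
  by apply: fold6_plus; rewrite ?bounds.
rewrite [leqRHS](_ : _ = size s) //.
by move: exceeded; rewrite /= !negb_and -!ltnNge; lia.
Qed.
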